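(* Let $X$ be a non-degenerate real random variable such that $\varphi(t):=\log \mathbb{E}[e^{tX}]$ is finite for all $t\ge 0$. Assume that there is $h>0$ such that $X\in h\mathbb{Z}=\{hn:n\in\mathbb{Z}\}$ with probability $1$, and that $h$ is the largest number with this property. Let $c_1:=\varphi'(1)-\varphi(1)$ and $c_2:=2\varphi'(2)-\varphi(2)$, and let $c\in(0,c_2)$. Let $\{X_{i,j}:(i,j)\in\mathbb{N}^2\}$ be independent copies of $X$, let $\{N_n\}_{n\in\mathbb{N}}$ be a sequence of natural numbers with $\lim_{n\to\infty}e^{-cn}N_n=1$, and let $Z_n=\sum_{i=1}^{N_n}\prod_{j=1}^n e^{X_{i,j}}$. Let $\alpha\in(0,2)$ be the unique solution of $I(\varphi'(\alpha))=c$, and let $\beta=\varphi'(\alpha)$. Set $$B_n=e^{b_n},\qquad b_n=\beta n-\alpha^{-1}\log\left(h^{-1}\sqrt{2\pi\varphi''(\alpha)n}\right),$$ $$A_n=\begin{cases}\mathbb{E}Z_n=N_ne^{\varphi(1)n}, & c\in(c_1,c_2),\\ N_n\mathbb{E}[e^{S_n}1_{S_n\le b_n}]\ \text{ with } S_n=\sum_{j=1}^nX_{1,j}, & c=c_1,\\ 0, & c\in(0,c_1).\end{cases}$$ Then $\left\{\frac{Z_n-A_n}{B_n}:n\in\mathbb{N}\right\}$ is a tight sequence of random variables.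
   Context: Non-degenerate means not almost surely constant. Under the hypothesis on $\varphi$, $\varphi$ is infinitely differentiable and strictly convex on $(0,\infty)$. With $\beta_0:=\lim_{t\to0+}\varphi'(t)=\mathbb{E}X\in[-\infty,\infty)$, the function $I:(\beta_0,+\infty)\to(0,+\infty]$ is defined by $I(\beta)=\sup_{t\ge0}(\beta t-\varphi(t))$. For every $\alpha>0$ one has $I(\varphi'(\alpha))=\alpha\varphi'(\alpha)-\varphi(\alpha)$; the function $\alpha\mapsto I(\varphi'(\alpha))$, $\alpha>0$, is continuous, strictly increasing and tends to $0$ as $\alpha\to0+$. In particular $c_1=I(\varphi'(1))$, $c_2=I(\varphi'(2))$ and $0<c_1<c_2<\infty$. *)

(* Defs.v *)
From HB Require Import structures.
From mathcomp Require Import all_boot all_order all_algebra finmap.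
From mathcomp Require Import all_classical all_reals all_analysis.

Set Implicit Arguments.
Unset Strict Implicit.
Unset Printing Implicit Defensive.

Import Order.TTheory GRing.Theory Num.Theory.
Import numFieldNormedType.Exports.

Local Open Scope ring_scope.
Local Open Scope classical_set_scope.

Section random_variables.
Context {R : realType} {d : measure_display} {T : measurableType d}.
Variable P : probability T R.

Definition nondegenerate_RV (X : {RV P >-> R}) : Prop :=
  ~ exists a : R, {ae P, forall w, X w = a}.

Definition on_lattice (X : {RV P >-> R}) (h : R) : Prop :=
  {ae P, forall w, exists k : int, X w = h * k%:~R}.

Definition log_mgfe (X : {RV P >-> R}) (t : R) : \bar R := lne ('M_P X t).

(* Meaningful only where log_mgfe is finite; finiteness on [0, +oo) makes the
   derivatives at positive points the usual ones. *)
Definition log_mgf (X : {RV P >-> R}) (t : R) : R := fine (log_mgfe X t).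

Definition mutually_independent {K : choiceType} (X : K -> {RV P >-> R}) : Prop :=
  forall (J : {fset K}) (B : K -> set R), (forall k, measurable (B k)) ->
    P (\bigcap_(k in [set` J]) (X k @^-1` B k)) =
      (\big[mule/1]_(k <- J) P (X k @^-1` B k))%E.

Definition tight (Y : nat -> T -> R) : Prop :=
  forall eps : R, 0 < eps ->
    exists M : R, forall n, (P [set w | (M < `|Y n w|)%R] <= eps%:E)%E.

End random_variables.
Arguments nondegenerate_RV {R d T} P X.
Arguments on_lattice {R d T} P X h.
Arguments log_mgfe {R d T} P X t.
Arguments log_mgf {R d T} P X t.
Arguments mutually_independent {R d T} P {K} X.

(* Laws are compared on measurable sets only: distribution P X is a function on
   all subsets of R, unconstrained on the non-measurable ones. *)
Definition is_copy {R : realType} {d d0 : measure_display}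
    {T : measurableType d} {T0 : measurableType d0}
    (P : probability T R) (P0 : probability T0 R)
    (Y : {RV P >-> R}) (X : {RV P0 >-> R}) : Prop :=
  forall B : set R, measurable B -> distribution P Y B = distribution P0 X B.
Arguments is_copy {R d d0 T T0} P P0 Y X.

(* The supremum runs over t >= 0 only, so this is not the full Legendre
   transform of phi. *)
Definition rate {R : realType} (phi : R -> R) (b : R) : \bar R :=
  ereal_sup [set (b * t - phi t)%:E | t in [set t : R | 0 <= t]].

Definition log_scaling {R : realType} (phi : R -> R) (alpha h : R) (n : nat) : R :=
  phi^`()%classic alpha * n%:R
  - alpha^-1 * ln (h^-1 * Num.sqrt (2 * pi * phi^`(2)%classic alpha * n%:R)).

(* Rows and columns of the array are numbered from 0, so that the first row,
   on which S_n is built, is X 0. *)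
Section random_exponentials.
Context {R : realType} {d : measure_display} {T : measurableType d}.
Variable P : probability T R.
Variable X : nat -> nat -> {RV P >-> R}.
Variable N : nat -> nat.

Definition rowsum (n : nat) (w : T) : R := \sum_(j < n) X 0 j w.

Definition sumexp (n : nat) (w : T) : R :=
  \sum_(i < N n) \prod_(j < n) expR (X i j w).

(* c1 is the critical value of c and b_ the sequence of truncation levels. *)
Definition centering (c1 c : R) (b_ : nat -> R) (n : nat) : R :=
  if c1 < c then fine 'E_P[sumexp n]
  else if c == c1 then
    (N n)%:R * fine 'E_P[fun w => expR (rowsum n w)
                                  * \1_[set v | rowsum n v <= b_ n] w]
  else 0.

End random_exponentials.
Arguments rowsum {R d T P} X n w.
Arguments sumexp {R d T P} X N n w.
Arguments centering {R d T} P X N c1 c b_ n.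

(* Main.v *)
(** Tilting by [expR (alpha * x)] turns every quantity below into an expectation
    under the tilted law of a row sum [S_n]. A nondegenerate lattice law has two
    atoms [a != b]; splitting off a multiple of the uniform law on [{a, b}] writes
    a power of the tilted law as a mixture in which, up to an exponentially rare
    event, order of [n] steps are fair coin flips, so that central binomial
    coefficients give the concentration bound
      [E[expR (alpha * S_n - kappa * `|S_n - t|)] <= C * M^n / sqrt n]
    uniformly in [t], where [M = expR (phi alpha)]. Together with
    [N_n ~ expR (c * n)] and [c = alpha * phi' alpha - phi alpha] it says that
    [N_n * E[u S_n]] is at most of order [expR (q + alpha * b_n)] as soon as
    [u x <= expR (q + alpha * x - kappa * `|x - t|)]. With [t = b_n + s] this
    one estimate bounds the probability that some row sum exceeds [t]
    ([kappa = alpha]), the variance of the sum truncated at [t]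
    ([kappa = 2 - alpha]), and the error made in replacing the mean of the
    truncated sum by the centering ([kappa = `|1 - alpha|], or [kappa = 1] when
    [alpha = 1]); Chebyshev's inequality concludes. Which case of the centering
    applies is decided by strict convexity of [phi]. *)

Require Import Defs.
From HB Require Import structures.
From mathcomp Require Import all_boot all_order all_algebra finmap.
From mathcomp Require Import all_classical all_reals all_analysis.
From mathcomp Require Import measurable_realfun ring lra zify.
Import Order.TTheory GRing.Theory Num.Theory.
Import numFieldNormedType.Exports.
Local Open Scope ring_scope.
Local Open Scope classical_set_scope.

(** * Binomial concentration *)

(** Coefficients increase up to the middle of the row, by [mul_bin_left]; the upper half follows by
    symmetry. *)
Lemma leq_bin_half (m j : nat) : ('C(m, j) <= 'C(m, m./2))%N.
Proof.
have up k : (k.*2 < m)%N -> ('C(m, k) <= 'C(m, k.+1))%N.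
  move=> km; rewrite -(leq_pmul2l (ltn0Sn k)) mul_bin_left leq_mul2r.
  by apply/orP; right; lia.
have mono i k : (i + k <= m./2)%N -> ('C(m, i) <= 'C(m, i + k))%N.
  elim: k => [|k IHk] ikm; first by rewrite addn0.
  rewrite addnS (leq_trans (IHk _))//; first lia.
  by apply: up; lia.
have low i : (i <= m./2)%N -> ('C(m, i) <= 'C(m, m./2))%N.
  by move=> im; rewrite -[X in (_ <= 'C(_, X))%N](subnKC im) mono// subnKC.
have [jm|mj] := leqP j m; last by rewrite bin_small.
have [|jm2] := leqP j m./2; first exact: low.
by rewrite -bin_sub// low//; lia.
Qed.

(** Squared form of ['C(2k, k) / 4^k <= 1 / sqrt (2k + 1)]. From [k] to [k + 1] the quotient is
    multiplied by [(2k + 1) / (2k + 2)], and [(2k + 1) (2k + 3) <= (2k + 2)^2]. *)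
Lemma central_bin_le (R : rcfType) (k : nat) :
  ('C(k.*2, k)%:R / 2 ^+ k.*2) ^+ 2 * k.*2.+1%:R <= 1 :> R.
Proof.
elim: k => [|k IHk]; first by rewrite bin0 expr0 divr1 expr1n mul1r.
have E : 'C(k.+1.*2, k.+1)%:R / 2 ^+ k.+1.*2 =
    ('C(k.*2, k)%:R / 2 ^+ k.*2) * (k.*2.+1%:R / k.*2.+2%:R) :> R.
  have H1 := mul_bin_diag k.+1.*2 k.
  have H2 := mul_bin_left k.*2.+1 k.
  have H3 := mul_bin_diag k.*2.+1 k.
  have Hs : 'C(k.*2.+1, k) = 'C(k.*2.+1, k.+1).
    by rewrite -bin_sub; [congr binomial|]; lia.
  have {}H1 : ('C(k.+1.*2, k.+1) = 2 * 'C(k.*2.+1, k))%N.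
    apply/eqP; rewrite -(eqn_pmul2l (ltn0Sn k)) -H1 doubleS /=.
    by apply/eqP; lia.
  have {}H3 : ((k.+1) * 'C(k.*2.+1, k) = k.*2.+1 * 'C(k.*2, k))%N.
    by rewrite Hs -H3.
  have {}H3 : (k.+1%:R) * 'C(k.*2.+1, k)%:R = k.*2.+1%:R * 'C(k.*2, k)%:R :> R.
    by rewrite -!natrM H3.
  have e2 : k.*2.+2%:R = 2 * k.+1%:R :> R by rewrite -natrM; congr _%:R; lia.
  rewrite H1 natrM doubleS !exprS e2.
  have k0 : k.+1%:R != 0 :> R by rewrite pnatr_eq0.
  have p0 : 2 ^+ k.*2 != 0 :> R by rewrite expf_neq0// pnatr_eq0.
  have -> : 'C(k.*2.+1, k)%:R = k.*2.+1%:R * 'C(k.*2, k)%:R / k.+1%:R :> R.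
    by rewrite -H3 mulrC mulKf.
  field.
  by rewrite p0 addrC natr1 k0.
rewrite E exprMn -mulrA.
apply: le_trans IHk; rewrite ler_wpM2l// ?sqr_ge0//.
rewrite expr_div_n mulrAC ler_pdivrMr ?exprn_gt0// -natrX -!natrM -natrX -natrM.
by rewrite ler_nat; nia.
Qed.

Lemma bin_expn_le (R : rcfType) (m j : nat) :
  'C(m, j)%:R / 2 ^+ m <= (Num.sqrt m.+1%:R)^-1 :> R.
Proof.
have suf p : (0 : R) <= p -> p ^+ 2 * m.+1%:R <= 1 -> p <= (Num.sqrt m.+1%:R)^-1.
  move=> p0 pm; rewrite -[leRHS]mul1r ler_pdivlMr ?sqrtr_gt0//.
  rewrite -(@ler_pXn2r _ 2)// ?nnegrE ?mulr_ge0 ?sqrtr_ge0//.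
  by rewrite exprMn sqr_sqrtr// expr1n.
apply: (@le_trans _ _ ('C(m, m./2)%:R / 2 ^+ m)).
  by rewrite ler_pM2r ?invr_gt0 ?exprn_gt0// ler_nat leq_bin_half.
apply: suf; first by rewrite divr_ge0// exprn_ge0.
have [k [->|->]] : exists k, m = k.*2 \/ m = k.*2.+1.
  by exists m./2; lia.
  by rewrite doubleK central_bin_le.
have -> : k.*2.+1./2 = k by lia.
(* The two middle coefficients of an odd row are equal and add up to the central one of the next
   row, so the even case applies. *)
have E : 'C(k.*2.+1, k)%:R / 2 ^+ k.*2.+1 = 'C(k.+1.*2, k.+1)%:R / 2 ^+ k.+1.*2 :> R.
  have Hs : 'C(k.*2.+1, k) = 'C(k.*2.+1, k.+1).
    by rewrite -bin_sub; [congr binomial|]; lia.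
  rewrite doubleS binS -Hs natrD [in RHS]exprS.
  by field; rewrite expf_neq0// pnatr_eq0.
rewrite E; apply: le_trans (central_bin_le R k.+1).
by rewrite ler_wpM2l ?sqr_ge0// ler_nat; lia.
Qed.

(** The estimate behind the recursion for [tilt_le]: [n, m |-> 1 / sqrt (m + 1 + n * r / 2)]
    is a supersolution of [F (n + 1) m = 2 r F n (m + 1) + (1 - 2 r) F n m]. *)
Lemma invsqrt_step (R : rcfType) (q u : R) : 0 <= q <= 1 -> 1 <= u ->
  q / Num.sqrt (u + 1) + (1 - q) / Num.sqrt u <= (Num.sqrt (u + q / 4))^-1.
Proof.
move=> /andP[q0 q1] u1.
have u0 : 0 < u by lra.
set v := Num.sqrt u; set w := Num.sqrt (u + 1); set z := Num.sqrt _.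
have v2 : v ^+ 2 = u by rewrite sqr_sqrtr// ltW.
have w2 : w ^+ 2 = u + 1 by rewrite sqr_sqrtr//; lra.
have z2 : z ^+ 2 = u + q / 4 by rewrite sqr_sqrtr//; lra.
have v0 : 0 < v by rewrite sqrtr_gt0.
have w0 : 0 < w by rewrite sqrtr_gt0; lra.
have z0 : 0 < z by rewrite sqrtr_gt0; lra.
have vz : v <= z by rewrite ler_sqrt; lra.
have w2v : w <= 2 * v by rewrite -(@ler_pXn2r _ 2)// ?nnegrE; nra.
(* The goal reads [v^-1 - z^-1 <= q * (v^-1 - w^-1)]; both sides are compared with
   [q / (8 * v ^+ 3)]. *)
have dvz : v^-1 - z^-1 <= q / (8 * v ^+ 3).
  have -> : v^-1 - z^-1 = (q / 4) / (v * z * (v + z)).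
    have <- : (z - v) * (z + v) = q / 4 by rewrite -subr_sqr z2 v2; ring.
    by field; rewrite !gt_eqF// addr_gt0.
  rewrite ler_pdivrMr ?mulr_gt0 ?addr_gt0// mulrAC ler_pdivlMr ?mulr_gt0 ?exprn_gt0//.
  have : v ^+ 3 <= v * z * v by rewrite 2!exprS expr1 mulrA ler_pM2r// ler_pM2l.
  have : v * z * v <= v * z * z by rewrite ler_pM2l ?mulr_gt0.
  by move=> ? ?; nra.
have dvw : (8 * v ^+ 3)^-1 <= v^-1 - w^-1.
  have -> : v^-1 - w^-1 = (v * w * (v + w))^-1.
    have e : (w - v) * (w + v) = 1 by rewrite -subr_sqr w2 v2; ring.
    have -> : (v * w * (v + w))^-1 = ((w - v) * (w + v)) / (v * w * (v + w)).
      by rewrite e mul1r.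
    by field; rewrite !gt_eqF// addr_gt0.
  rewrite lef_pV2 ?posrE ?mulr_gt0 ?exprn_gt0 ?addr_gt0//.
  have : v * w * (v + w) <= v * (2 * v) * (v + 2 * v).
    by rewrite ler_pM ?mulr_ge0 ?addr_ge0 ?ltW//; nra.
  have : 0 < v ^+ 3 by rewrite exprn_gt0.
  by rewrite !exprS expr0; lra.
have := ler_wpM2l q0 dvw; rewrite mulrBr.
have -> : (1 - q) / v = v^-1 - q / v by ring.
by lra.
Qed.

(** The points form a progression of step [delta], so the summands decay geometrically on both sides
    of the origin, wherever the progression starts. *)
Lemma sum_exp_dist_le (R : realType) (kappa delta : R) :
  0 < kappa -> delta != 0 ->
  exists2 K, 0 < K & forall (m : nat) (z : R),
    \sum_(j < m) expR (- (kappa * `|z + j%:R * delta|)) <= K.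
Proof.
move=> k0 d0.
wlog dpos : delta d0 / 0 < delta.
  move=> wl; have [dpos|dneg|e] := ltgtP delta 0; last by rewrite e eqxx in d0.
    have [||K K0 HK] := wl (- delta); rewrite ?oppr_eq0// ?oppr_gt0//.
    exists K => // m z; apply: le_trans (HK m (- z)).
    by apply: ler_sum => j _; rewrite mulrN -opprD normrN.
  exact: wl.
pose q := expR (- (kappa * delta)).
have q0 : 0 < q by exact: expR_gt0.
have q1 : q < 1 by rewrite -expR0 ltr_expR oppr_lt0 mulr_gt0.
pose G m z := \sum_(j < m) expR (- (kappa * `|z + j%:R * delta|)).
have GS m z : G m.+1 z = expR (- (kappa * `|z|)) + G m (z + delta).
  rewrite /G big_ord_recl mul0r addr0; congr (_ + _); apply: eq_bigr => j _.
  by rewrite lift0 -natr1; congr (expR (- (_ * `| _ |))); ring.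
pose c := (1 - q)^-1.
have c0 : 0 < c by rewrite invr_gt0 subr_gt0.
(* Fixed-point equation of the geometric series; it closes the induction in [Gpos]. *)
have cq : c = 1 + c * q.
  apply/eqP; rewrite -subr_eq -{1}[c]mulr1 -mulrBr mulVf//.
  by rewrite gt_eqF// subr_gt0.
have Gpos m z : 0 <= z -> G m z <= c * expR (- (kappa * z)).
  elim: m z => [|m IH] z z0.
    by rewrite /G big_ord0 mulr_ge0 ?expR_ge0// ltW.
  have zd : 0 <= z + delta by rewrite addr_ge0// ltW.
  rewrite GS ger0_norm//; apply: (le_trans (lerD (lexx _) (IH _ zd))).
  by rewrite mulrDr opprD expRD [X in _ <= X * _]cq mulrDl mul1r -/q mulrAC mulrA.
(* [fun z => 1 + 2 * c - c * q * expR (kappa * z)] is a potential decreasing by at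
   least one summand per step, as long as the walk stays below [0]. *)
have Gneg m z : z < 0 -> G m z <= 1 + 2 * c - c * q * expR (kappa * z).
  elim: m z => [|m IH] z z0.
    rewrite /G big_ord0.
    have e1 : expR (kappa * z) <= 1 by rewrite -expR0 ler_expR; nra.
    have : c * q * expR (kappa * z) <= c * q by rewrite ler_piMr// mulr_ge0// ltW.
    by nra.
  rewrite GS ltr0_norm// mulrN opprK.
  have [zd|zd] := ltP (z + delta) 0.
    apply: (le_trans (lerD (lexx _) (IH _ zd))).
    have -> : expR (kappa * (z + delta)) = expR (kappa * z) / q.
      by rewrite /q expRN invrK -expRD mulrDr.
    have := expR_gt0 (kappa * z).
    have -> : c * q * (expR (kappa * z) / q) = c * expR (kappa * z).
      by field; rewrite gt_eqF.
    by nra.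
  apply: (le_trans (lerD (lexx _) (Gpos _ _ zd))).
  have e1 : expR (kappa * z) <= 1 by rewrite -expR0 ler_expR; nra.
  have e2 : expR (- (kappa * (z + delta))) <= 1 by rewrite -expR0 ler_expR; nra.
  have : c * expR (- (kappa * (z + delta))) <= c by rewrite ler_piMr// ltW.
  have : c * q * expR (kappa * z) <= c * q by rewrite ler_piMr// mulr_ge0// ltW.
  by nra.
exists (1 + 2 * c) => [|m z]; first by nra.
have [z0|z0] := ltP z 0.
  apply: (le_trans (Gneg m z z0)); have := expR_gt0 (kappa * z).
  have : 0 < c * q by rewrite mulr_gt0.
  by nra.
apply: (le_trans (Gpos m z z0)).
have e1 : expR (- (kappa * z)) <= 1 by rewrite -expR0 ler_expR; nra.
have : c * expR (- (kappa * z)) <= c by rewrite ler_piMr// ltW.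
by nra.
Qed.

(** Markov operator of a fair coin flip between the steps [a] and [b]; its iterates average over [m]
    flips without any product space. *)
Definition two_point_mean {R : realType} (a b : R) (g : R -> R) (x : R) : R :=
  (g (x + a) + g (x + b)) / 2.

Lemma iter_two_point_mean (R : realType) (a b : R) (g : R -> R) (m : nat) (x : R) :
  iter m (two_point_mean a b) g x =
  \sum_(j < m.+1) 'C(m, j)%:R / 2 ^+ m * g (x + m%:R * b + j%:R * (a - b)).
Proof.
elim: m x => [|m IH] x.
  by rewrite big_ord_recl big_ord0 bin0 expr0 divr1 mul1r !mul0r !addr0.
rewrite iterS {1}/two_point_mean !IH.
have E1 : \sum_(j < m.+1) 'C(m, j)%:R / 2 ^+ m * g (x + a + m%:R * b + j%:R * (a - b)) =
  \sum_(j < m.+1) 'C(m, j)%:R / 2 ^+ m * g (x + m.+1%:R * b + j.+1%:R * (a - b)).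
  by apply: eq_bigr => j _; rewrite -!natr1; congr (_ * g _); ring.
(* The added term [j = m.+1] is zero because ['C(m, m.+1) = 0]; the two sums can then be matched by
   Pascal's rule. *)
have E2 : \sum_(j < m.+1) 'C(m, j)%:R / 2 ^+ m * g (x + b + m%:R * b + j%:R * (a - b)) =
  \sum_(j < m.+2) 'C(m, j)%:R / 2 ^+ m * g (x + m.+1%:R * b + j%:R * (a - b)).
  rewrite [RHS]big_ord_recr/= bin_small// !mul0r addr0.
  by apply: eq_bigr => j _; rewrite -!natr1; congr (_ * g _); ring.
rewrite E1 E2 [in X in _ + X]big_ord_recl [RHS]big_ord_recl !bin0 addrCA mulrDl -big_split/=.
congr (_ + _); first by rewrite [in RHS]exprS; field; rewrite expf_neq0// pnatr_eq0.
rewrite mulr_suml; apply: eq_bigr => j _; rewrite /bump leq0n add1n binS natrD exprS.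
by field; rewrite expf_neq0// pnatr_eq0.
Qed.

(** Each binomial weight is at most [1 / sqrt (m + 1)], and what remains is a sum over a progression
    of step [a - b], bounded by [sum_exp_dist_le]. *)
Lemma iter_two_point_mean_le (R : realType) (a b kappa : R) :
  0 < kappa -> a != b ->
  exists2 K, 0 < K & forall (t : R) (m : nat) (x : R),
    iter m (two_point_mean a b) (fun y => expR (- (kappa * `|y - t|))) x
      <= K / Num.sqrt m.+1%:R.
Proof.
move=> k0 ab; have [|K K0 HK] := sum_exp_dist_le _ _ (a - b) k0.
  by rewrite subr_eq0.
exists K => // t m x; rewrite iter_two_point_mean.
apply: (@le_trans _ _ (\sum_(j < m.+1) (Num.sqrt m.+1%:R)^-1 *
    expR (- (kappa * `|(x + m%:R * b - t) + j%:R * (a - b)|)))).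
  apply: ler_sum => j _; rewrite ler_pM ?expR_ge0 ?bin_expn_le//.
  by rewrite addrAC.
by rewrite -mulr_sumr mulrC ler_pM2r ?HK// invr_gt0 sqrtr_gt0.
Qed.

(** * Powers of a tilted law with two atoms *)

Section tilted_convolution_powers.
Context {R : realType}.
Variables (nu : probability R R) (Q : nat -> probability R R).
Hypothesis Q0 : forall f : R -> \bar R, measurable_fun [set: R] f ->
  (forall x, 0 <= f x)%E -> (\int[Q 0]_x f x = f 0%R)%E.
Hypothesis QS : forall n (f : R -> \bar R), measurable_fun [set: R] f ->
  (forall x, 0 <= f x)%E ->
  (\int[Q n.+1]_x f x = \int[nu]_y \int[Q n]_x f (x + y)%R)%E.
Variables (alpha M : R).
Hypothesis nuM : (\int[nu]_y (expR (alpha * y))%:E = M%:E)%E.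

Let mexp : measurable_fun [set: R] (fun y : R => expR (alpha * y)).
Proof. by apply: measurableT_comp => //; exact: measurable_funM. Qed.

(** Convolution of [G] with the tilted law of [n] steps, left unnormalised: its total mass is
    [M ^+ n]. *)
Let tilt n (G : R -> R) (x : R) : \bar R :=
  (\int[Q n]_s (expR (alpha * s) * G (x + s))%:E)%E.

Let madd (x : R) : measurable_fun [set: R] (fun s : R => x + s).
Proof. exact: measurable_funD. Qed.

Let mtilt n (G : R -> R) : measurable_fun [set: R] G -> (forall x, 0 <= G x) ->
  measurable_fun [set: R] (tilt n G).
Proof.
move=> mG G0.
apply: (measurable_fun_fubini_tonelli_F (m2 := Q n)
  (fun z : R * R => (expR (alpha * z.2) * G (z.1 + z.2))%:E)).
  apply/measurable_EFinP/measurable_funM; first exact: (measurableT_comp mexp).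
  by apply: (measurableT_comp mG); apply: measurable_funD.
by move=> z; rewrite lee_fin mulr_ge0// expR_ge0.
Qed.

Let mtiltfun (G : R -> R) (x : R) : measurable_fun [set: R] G ->
  measurable_fun [set: R] (fun s : R => (expR (alpha * s) * G (x + s))%:E).
Proof.
move=> mG; apply/measurable_EFinP/measurable_funM; first exact: mexp.
exact: measurableT_comp.
Qed.

Let tilt0 (G : R -> R) x : measurable_fun [set: R] G -> (forall x, 0 <= G x) ->
  tilt 0 G x = (G x)%:E.
Proof.
move=> mG G0; rewrite /tilt Q0 ?mulr0 ?expR0 ?mul1r ?addr0//; first exact: mtiltfun.
by move=> s; rewrite lee_fin mulr_ge0 ?expR_ge0.
Qed.

Let tiltS n (G : R -> R) x : measurable_fun [set: R] G -> (forall x, 0 <= G x) ->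
  tilt n.+1 G x = (\int[nu]_y ((expR (alpha * y))%:E * tilt n G (x + y)%R))%E.
Proof.
move=> mG G0; rewrite /tilt QS; [|exact: mtiltfun|]; last first.
  by move=> s; rewrite lee_fin mulr_ge0 ?expR_ge0.
apply: eq_integral => y _; rewrite -ge0_integralZl//.
- apply: eq_integral => s _; rewrite -EFinM mulrDr expRD mulrA.
  by rewrite (addrC s) (addrA x) (mulrC (expR (alpha * y))).
- exact: mtiltfun.
- by move=> s _; rewrite lee_fin mulr_ge0 ?expR_ge0.
Qed.

(** A coin flip commutes with the [n] tilted steps. The factor 2 keeps division out of [\bar R]. *)
Let tilt_mean n (a b : R) (G : R -> R) x :
  measurable_fun [set: R] G -> (forall x, 0 <= G x) ->
  (2%:E * tilt n (two_point_mean a b G) x = tilt n G (x + a) + tilt n G (x + b))%E.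
Proof.
move=> mG G0; rewrite /tilt -ge0_integralZl//.
- rewrite -ge0_integralD//; [|by move=> *; rewrite lee_fin mulr_ge0 ?expR_ge0
    |exact: mtiltfun|by move=> *; rewrite lee_fin mulr_ge0 ?expR_ge0
    |exact: mtiltfun].
  apply: eq_integral => s _; rewrite -EFinM -EFinD /two_point_mean; congr EFin.
  by rewrite !(addrAC x _ s); field.
- apply: mtiltfun; apply: measurable_funM => //.
  by apply: measurable_funD; apply: measurableT_comp => //; exact: measurable_funD.
- by move=> s _; rewrite lee_fin !mulr_ge0 ?expR_ge0 ?addr_ge0.
Qed.

Variables (a b r : R).
Hypothesis ab : a != b.
Hypotheses (M_gt0 : 0 < M) (r_gt0 : 0 < r).
(** After division by [M], the tilted law contains [2 * r] times the uniform law on the two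
    atoms. *)
Hypothesis rM : forall y, y \in [:: a; b] ->
  ((r * M)%:E <= (expR (alpha * y))%:E * nu [set y])%E.

Let two_atoms_le (g : R -> R) : measurable_fun [set: R] g -> (forall x, 0 <= g x) ->
  ((r * M * (g a + g b))%:E <= \int[nu]_y (expR (alpha * y) * g y)%:E)%E.
Proof.
move=> mg g0.
pose c y := expR (alpha * y) * g y.
have c0 y : 0 <= c y by rewrite mulr_ge0 ?expR_ge0.
have mc : measurable_fun [set: R] (EFin \o c).
  by apply/measurable_EFinP/measurable_funM => //; exact: mexp.
have m1 y : measurable_fun [set: R] (fun x : R => (c y)%:E * (\1_[set y] x)%:E)%E.
  by apply: emeasurable_funM => //; apply/measurable_EFinP/measurable_indic.
have p1 y x : (0 <= (c y)%:E * (\1_[set y] x)%:E)%E.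
  by rewrite mule_ge0// lee_fin.
have i1 y : (\int[nu]_x ((c y)%:E * (\1_[set y] x)%:E) = (c y)%:E * nu [set y])%E.
  rewrite ge0_integralZl// ?lee_fin//; last by apply/measurable_EFinP/measurable_indic.
  by rewrite integral_indic// setIT.
apply: (@le_trans _ _ (\int[nu]_x ((c a)%:E * (\1_[set a] x)%:E +
                                   (c b)%:E * (\1_[set b] x)%:E))%E).
  rewrite ge0_integralD// !i1 mulrDr EFinD leeD//.
    rewrite /c EFinM [in leRHS]EFinM muleAC [leRHS]muleC [leLHS]muleC.
    by rewrite lee_wpmul2l ?lee_fin// rM// !inE eqxx.
  rewrite /c EFinM [in leRHS]EFinM muleAC [leRHS]muleC [leLHS]muleC.
  by rewrite lee_wpmul2l ?lee_fin// rM// !inE eqxx orbT.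
apply: ge0_le_integral => //.
- by move=> x _; rewrite adde_ge0.
- exact: emeasurable_funD.
move=> x _; rewrite -!EFinM -EFinD lee_fin !indicE.
have [->|xa] := eqVneq x a.
  rewrite (mem_set (erefl a : [set a] a)) memNset ?mulr1 ?mulr0 ?addr0//.
  by apply/eqP.
rewrite memNset ?mulr0 ?add0r; last exact/eqP.
have [->|xb] := eqVneq x b; first by rewrite mem_set// mulr1.
by rewrite memNset; [rewrite mulr0; exact: c0|exact/eqP].
Qed.

(** The two atoms carry at most the total tilted mass [M]. *)
Let r12 : 2 * r <= 1.
Proof.
have := @two_atoms_le (fun=> 1) (measurable_cst _) (fun=> ler01).
under eq_integral do rewrite mulr1.
by rewrite nuM lee_fin -{2}[M]mul1r mulrAC ler_pM2r// mulrC.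
Qed.

(* Only the mass [r * M] at each of [a] and [b] is kept where [f < L]. *)
Let two_atom_step (L : R) (f : R -> R) : measurable_fun [set: R] f ->
  (forall x, 0 <= f x <= L) ->
  (\int[nu]_y (expR (alpha * y) * f y)%:E <=
     (M * ((1 - 2 * r) * L + r * (f a + f b)))%:E)%E.
Proof.
move=> mf fL.
have f0 x : 0 <= f x by have /andP[] := fL x.
have Lf0 x : 0 <= L - f x by rewrite subr_ge0; have /andP[] := fL x.
have L0 : 0 <= L by have /andP[? /(le_trans _)] := fL a; exact.
have mLf : measurable_fun [set: R] (fun x => L - f x) by exact: measurable_funB.
have mm (g : R -> R) : measurable_fun [set: R] g ->
    measurable_fun [set: R] (fun y : R => (expR (alpha * y) * g y)%:E).
  by move=> mg; apply/measurable_EFinP/measurable_funM => //; exact: mexp.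
(* [two_atoms_le] bounds the integral of the deficit [L - f] from below; this identity turns that
   into an upper bound for [f]. *)
have E : (\int[nu]_y (expR (alpha * y) * f y)%:E +
    \int[nu]_y (expR (alpha * y) * (L - f y))%:E = (M * L)%:E)%E.
  rewrite -ge0_integralD//; [|by move=> *; rewrite lee_fin mulr_ge0 ?expR_ge0
    |exact: mm|by move=> *; rewrite lee_fin mulr_ge0 ?expR_ge0|exact: mm].
  under eq_integral do rewrite -EFinD -mulrDr subrKC mulrC EFinM.
  rewrite ge0_integralZl// ?nuM -?EFinM 1?mulrC//.
  by apply/measurable_EFinP; exact: mexp.
have := @two_atoms_le _ mLf Lf0; move: E.
set I1 := integral _ _ _; set I2 := integral _ _ _.
have : (0 <= I1)%E by apply: integral_ge0 => y _; rewrite lee_fin mulr_ge0 ?expR_ge0.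
have : (0 <= I2)%E by apply: integral_ge0 => y _; rewrite lee_fin mulr_ge0 ?expR_ge0.
case: I1 => [v| |]//; case: I2 => [u| |]// _ _ [vu]; rewrite !lee_fin => h.
have -> : M * ((1 - 2 * r) * L + r * (f a + f b)) = M * L - r * M * (L - f a + (L - f b)).
  by ring.
by rewrite -vu; lra.
Qed.

Variables (K : R) (g : R -> R).
Hypotheses (mg : measurable_fun [set: R] g) (g0 : forall x, 0 <= g x).
Hypothesis gK : forall m x, iter m (two_point_mean a b) g x <= K / Num.sqrt m.+1%:R.

Let mV m : measurable_fun [set: R] (iter m (two_point_mean a b) g).
Proof.
elim: m => [|m IH] //=; apply: measurable_funM => //.
by apply: measurable_funD; apply: measurableT_comp => //; exact: measurable_funD.
Qed.

Let V0 m x : 0 <= iter m (two_point_mean a b) g x.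
Proof. by elim: m x => [|m IH] x //=; rewrite divr_ge0// addr_ge0. Qed.

(** Here [m] counts the coin flips already absorbed into the test function. One more step is a flip
    with weight [2 * r], which raises [m] by one, or an arbitrary step, for which the bound uniform
    in [x] is used. Hence the induction on [n] leaves [m] and [x] free. *)
Let tilt_le n m x : (tilt n (iter m (two_point_mean a b) g) x <=
  (K * M ^+ n / Num.sqrt (m.+1%:R + n%:R * (r / 2)))%:E)%E.
Proof.
have K0 : 0 <= K.
  by have := gK 0 0; rewrite sqrtr1 divr1 => /(le_trans _); apply; exact: V0.
elim: n m x => [|n IH] m x.
  by rewrite tilt0// lee_fin expr0 mulr1 mul0r addr0.
set F := fun m => K * M ^+ n / Num.sqrt (m.+1%:R + n%:R * (r / 2)).
have tilt_ge0 j y : (0 <= tilt n (iter j (two_point_mean a b) g) y)%E.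
  by apply: integral_ge0 => s _; rewrite lee_fin mulr_ge0 ?expR_ge0.
have tilt_fin j y : tilt n (iter j (two_point_mean a b) g) y \is a fin_num.
  by rewrite ge0_fin_numE// (le_lt_trans (IH _ _))// ltry.
pose f y := fine (tilt n (iter m (two_point_mean a b) g) (x + y)).
have mf : measurable_fun [set: R] f.
  apply/measurable_EFinP.
  have -> : EFin \o f = tilt n (iter m (two_point_mean a b) g) \o (fun y => x + y).
    by apply/funext => y; rewrite /= /f fineK.
  by apply: measurableT_comp; [exact: mtilt (mV m) (V0 m)|exact: madd].
rewrite tiltS//.
under eq_integral do rewrite -(fineK (tilt_fin _ _)) -EFinM.
apply: (le_trans (@two_atom_step (F m) f mf _)).
  move=> y; rewrite fine_ge0//= -lee_fin fineK//; exact: IH.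
(* The values at the two atoms recombine into one coin flip, so the induction hypothesis at [m.+1]
   applies. *)
have fab : f a + f b <= 2 * F m.+1.
  rewrite -lee_fin EFinD /f !fineK// -tilt_mean//.
  by rewrite EFinM lee_wpmul2l//; exact: (IH m.+1 x).
rewrite lee_fin.
apply: (@le_trans _ _ (M * ((1 - 2 * r) * F m + r * (2 * F m.+1)))).
  by rewrite ler_pM2l// lerD2l ler_pM2l.
have r2 : 0 <= 2 * r <= 1 by rewrite r12 mulr_ge0// ltW.
have u1 : 1 <= m.+1%:R + n%:R * (r / 2).
  by rewrite ler_wpDr ?ler1n// mulr_ge0// divr_ge0// ltW.
(* With [q = 2 * r], the gain [q / 4] under the root is the increment [r / 2] of one step. *)
have := @invsqrt_step R (2 * r) _ r2 u1.
have -> : m.+1%:R + n%:R * (r / 2) + 1 = m.+2%:R + n%:R * (r / 2) :> R.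
  by rewrite -[m.+2%:R]natr1; ring.
have -> : m.+1%:R + n%:R * (r / 2) + 2 * r / 4 = m.+1%:R + n.+1%:R * (r / 2) :> R.
  by rewrite -[n.+1%:R]natr1; field.
have KM : 0 <= K * M ^+ n.+1 by rewrite mulr_ge0// exprn_ge0// ltW.
move=> /(ler_wpM2l KM); apply: le_trans; rewrite /F exprS le_eqVlt; apply/orP; left.
by apply/eqP; ring.
Qed.

(** Case [m = 0], [x = 0] of [tilt_le]; since [r / 2 <= 1], the number under the root is at least
    [(n + 1) * (r / 2)]. *)
Lemma tilted_power_le n :
  (\int[Q n]_s (expR (alpha * s) * g s)%:E <=
    (K / Num.sqrt (r / 2) * M ^+ n / Num.sqrt n.+1%:R)%:E)%E.
Proof.
have := tilt_le n 0 0; rewrite /tilt /=; under eq_integral do rewrite add0r.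
move/le_trans; apply; rewrite lee_fin.
have K0 : 0 <= K.
  by have := gK 0 0; rewrite sqrtr1 divr1 => /(le_trans _); apply; exact: V0.
rewrite [leRHS](_ : _ = K * M ^+ n * (Num.sqrt (r / 2) * Num.sqrt n.+1%:R)^-1).
  2: by rewrite invfM; ring.
rewrite ler_wpM2l ?mulr_ge0 ?exprn_ge0 ?(ltW M_gt0)//.
have rn : 0 <= n%:R * (r / 2) by rewrite mulr_ge0// divr_ge0// ltW.
rewrite -sqrtrM ?divr_ge0 ?(ltW r_gt0)// lef_pV2 ?posrE ?sqrtr_gt0 ?mulr_gt0 ?divr_gt0//.
  rewrite ler_sqrt; last by rewrite addr_ge0.
  by rewrite -[n.+1%:R]natr1; move: r12; lra.
by rewrite ltr_wpDr.
Qed.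

End tilted_convolution_powers.

(** * Partial sums of independent families *)

(** Rectangles are stable under intersection and generate the product sigma-algebra. *)
Lemma measure_unique_rect d1 d2 (T1 : measurableType d1) (T2 : measurableType d2)
    (R : realType) (m1 m2 : {measure set (T1 * T2) -> \bar R}) :
  (m1 [set: T1 * T2] < +oo)%E ->
  (forall A B, measurable A -> measurable B -> m1 (A `*` B) = m2 (A `*` B)) ->
  forall C, measurable C -> m1 C = m2 C.
Proof.
move=> m1T m12 C mC.
pose G : set (set (T1 * T2)) :=
  [set C | exists A, measurable A /\ exists B, measurable B /\ C = A `*` B].
apply: (measure_unique G (fun=> setT)) => //.
- rewrite measurable_prod_measurableType //; congr (<<s _ >>).
  rewrite predeqE; split => [[A mA [B mB <-]]|[A [mA [B [mB ->]]]]].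
    by exists A; split => //; exists B.
  by exists A => //; exists B.
- move=> _ _ [X1 [mX1 [X2 [mX2 ->]]]] [Y1 [mY1 [Y2 [mY2 ->]]]].
  rewrite -setXI; exists (X1 `&` Y1); split; first exact: measurableI.
  by exists (X2 `&` Y2); split => //; exact: measurableI.
- by move=> _; exists setT; split => //; exists setT; split => //; rewrite setXTT.
- by rewrite bigcup_const.
- by move=> _ [A [mA [B [mB ->]]]]; exact: m12.
Qed.

(** The joint law agrees with the product law on rectangles, hence everywhere; Tonelli's theorem
    then iterates the integral. *)
Lemma ge0_integral_indep (R : realType) d (T : measurableType d)
    (P : probability T R) (Y Z : {RV P >-> R}) (g : R * R -> \bar R) :
  (forall A B, measurable A -> measurable B ->
    P (Y @^-1` A `&` Z @^-1` B) = (P (Y @^-1` A) * P (Z @^-1` B))%E) ->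
  measurable_fun [set: R * R] g -> (forall z, 0 <= g z)%E ->
  (\int[P]_w g (Y w, Z w) =
    \int[distribution P Z]_y \int[distribution P Y]_x g (x, y))%E.
Proof.
move=> indep mg g0.
have mYZ : measurable_fun [set: T] (fun w => (Y w, Z w)).
  by apply/measurable_fun_pairP; split.
have <- : (\int[pushforward P (fun w => (Y w, Z w))]_z g z =
           \int[P]_w g (Y w, Z w))%E by rewrite ge0_integral_pushforward.
transitivity (\int[(distribution P Y \x distribution P Z)%E]_z g z)%E.
  apply: eq_measure_integral => /= A mA _; symmetry.
  by apply: product_measure_unique => // B C mB mC; rewrite -indep.
by rewrite fubini_tonelli2.
Qed.

(** The enumeration [u] of indices lets one definition serve every row of a doubly indexed
    family. *)
Definition partial_sum {R : realType} {d : measure_display}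
    {T : measurableType d} {P : probability T R} {K : Type}
    (X : K -> {RV P >-> R}) (u : nat -> K) (n : nat) : {RV P >-> R} :=
  \sum_(j < n) X (u j).

Lemma partial_sumE {R : realType} {d : measure_display} {T : measurableType d}
    {P : probability T R} {K : Type} (X : K -> {RV P >-> R}) u n w :
  partial_sum X u n w = \sum_(j < n) X (u j) w.
Proof. exact: mfun_sum. Qed.

Section independent_sums.
Context {R : realType} {d : measure_display} {T : measurableType d}.
Variables (P : probability T R) (K : choiceType) (X : K -> {RV P >-> R}).
Hypothesis indX : mutually_independent P X.

Let cyl (J : {fset K}) (B : K -> set R) : set T :=
  (\bigcap_(k in [set` J]) (X k @^-1` B k))%classic.

Let mcyl J B : (forall k, measurable (B k)) -> measurable (cyl J B).
Proof.
move=> mB; apply: fin_bigcap_measurable => // k _.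
exact: measurable_funPTI.
Qed.

Let cylU k J B : k \notin J -> cyl (k |` J)%fset B = (X k @^-1` B k `&` cyl J B)%classic.
Proof.
move=> kJ; rewrite /cyl; apply/seteqP; split => w /=.
  move=> H; split; first by apply: (H k); rewrite /= !inE eqxx.
  by move=> j jJ; apply: H; rewrite /= !inE jJ orbT.
move=> [H1 H2] j; rewrite /= !inE => /orP[/eqP ->//|]; exact: H2.
Qed.

Let P_cylU k J B : (forall k, measurable (B k)) -> k \notin J ->
  P (cyl (k |` J)%fset B) = (P (X k @^-1` B k) * P (cyl J B))%E.
Proof.
move=> mB kJ; rewrite /cyl !indX// big_fsetU1//.
Qed.

(** [F] stands for an event already known to be independent of the family outside
    [D]; taking for [F] an event on another partial sum makes partial sums over
    disjoint index sets independent. *)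
Lemma indep_sum (n : nat) (u : nat -> K) : injective u ->
  forall (D : set K) (F : set T), measurable F ->
  (forall (J : {fset K}) (B : K -> set R), (forall k, measurable (B k)) ->
    (forall k, k \in J -> ~ D k) ->
    P (F `&` cyl J B)%classic = (P F * P (cyl J B))%E) ->
  (forall j, ~ D (u j)) ->
  forall (A : set R) (J : {fset K}) (B : K -> set R),
    measurable A -> (forall k, measurable (B k)) ->
    (forall k, k \in J -> ~ D k /\ forall j, (j < n)%N -> k != u j) ->
  P (F `&` partial_sum X u n @^-1` A `&` cyl J B)%classic =
    (P F * P (partial_sum X u n @^-1` A) * P (cyl J B))%E.
Proof.
move=> uinj; elim: n => [|n IH] D F mF hF uD A J B mA mB hJ.
  have -> : partial_sum X u 0 @^-1` A = (if 0 \in A then setT else set0)%classic.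
    have S0 w : partial_sum X u 0 w = 0 by rewrite partial_sumE big_ord0.
    apply/seteqP; split => w /=; rewrite S0; first by move=> A0; rewrite mem_set.
    by case: ifPn => // /set_mem.
  have hFJ := hF J B mB (fun k kJ => (hJ k kJ).1).
  by case: ifP => _; rewrite ?setIT ?setI0 ?set0I ?measure0 ?mule0 ?mul0e
    ?probability_setT ?mule1.
pose S := partial_sum X u n; pose G := cyl J B.
have mG : measurable G by exact: mcyl.
have mFG : measurable (F `&` G) by exact: measurableI.
have mpair : measurable_fun [set: T] (fun w => (S w, X (u n) w)).
  by apply/measurable_fun_pairP; split.
have unJ : u n \notin J.
  by apply/negP => /hJ[_ /(_ n (ltnSn n))]; rewrite eqxx.
have hFG : P (F `&` G) = (P F * P G)%E by apply: hF => // k /hJ[].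
have rect A1 A2 : measurable A1 -> measurable A2 ->
    P (S @^-1` A1 `&` X (u n) @^-1` A2 `&` (F `&` G)) =
    (P F * P G * P (S @^-1` A1 `&` X (u n) @^-1` A2))%E.
  move=> mA1 mA2.
  (* [B'] adds the constraint [A2] at [u n]; as [u n] is not in [J], the cylinder over [J] is
     unchanged. *)
  pose B' k := if k == u n then A2 else B k.
  have mB' k : measurable (B' k) by rewrite /B'; case: ifP.
  have B'n : B' (u n) = A2 by rewrite /B' eqxx.
  have cylJ : cyl J B' = G.
    rewrite /cyl; apply: eq_bigcapr => k /= kJ; rewrite /B'.
    by case: eqP => // e; rewrite -e kJ in unJ.
  have -> : S @^-1` A1 `&` X (u n) @^-1` A2 `&` (F `&` G) =
     F `&` S @^-1` A1 `&` cyl (u n |` J)%fset B'.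
    by rewrite cylU// B'n cylJ; apply/seteqP; split => w /=; tauto.
  rewrite (IH D F)// => [|k]; last first.
    rewrite !inE => /orP[/eqP ->|kJ].
      split => // j jn; apply/negP => /eqP/uinj e.
      by rewrite e ltnn in jn.
    by have [kD kn] := hJ k kJ; split => // j jn; apply: kn; exact: ltnW.
  rewrite P_cylU// B'n cylJ.
  have -> : P (S @^-1` A1 `&` X (u n) @^-1` A2) =
     (P (S @^-1` A1) * P (X (u n) @^-1` A2))%E.
    (* With the trivial event, the induction hypothesis makes [S] and [X (u n)] independent. *)
    have := IH set0 setT measurableT.
    have c1 : cyl [fset u n]%fset B' = X (u n) @^-1` A2.
      by rewrite /cyl set_fset1 bigcap_set1 B'n.
    move=> /(_ _ _ A1 [fset u n]%fset B' mA1 mB'); rewrite c1 setTI probability_setT mul1e.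
    apply => [J0 B0 mB0 _|j []|k].
      by rewrite setTI mul1e.
    rewrite inE => /eqP ->; split => // j jn; apply/negP => /eqP/uinj e.
    by rewrite e ltnn in jn.
  by rewrite -!muleA; congr (_ * _)%E; rewrite muleA muleC.
have PFG0 : (0 <= fine (P F * P G))%R by rewrite fine_ge0// mule_ge0.
pose C : set (R * R) := (fun z => z.1 + z.2) @^-1` A.
have mC : measurable C.
  have mD : measurable_fun [set: R * R] (fun z => z.1 + z.2) by exact: measurable_funD.
  by rewrite -[C]setTI; exact: mD.
have sumS : partial_sum X u n.+1 @^-1` A = (fun w => (S w, X (u n) w)) @^-1` C.
  apply/seteqP; split => w; rewrite /= /C /= /S !partial_sumE.
  by rewrite big_ord_recr/=.
  by rewrite big_ord_recr/=.
have PFGE : ((fine (P F * P G))%:E = P F * P G)%E.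
  by rewrite fineK// fin_numM ?fin_num_measure.
pose pair w := (S w, X (u n) w).
(* Both sides are measures in [C] and agree on rectangles by [rect]; [C] itself need not be a
   rectangle. *)
have H : P (pair @^-1` C `&` (F `&` G)) = (P F * P G * P (pair @^-1` C))%E.
  rewrite -PFGE.
  apply: (@measure_unique_rect _ _ _ _ R
    (pushforward (mrestr P mFG) pair)
    (mscale (NngNum PFG0) (pushforward P pair)) _ _ C mC).
    change (P (pair @^-1` setT `&` (F `&` G)) < +oo)%E.
    by rewrite preimage_setT setTI ltey_eq fin_num_measure.
  move=> A1 A2 mA1 mA2.
  transitivity ((fine (P F * P G))%:E * P (S @^-1` A1 `&` X (u n) @^-1` A2))%E => //.
  by rewrite PFGE; exact: rect.
have -> : F `&` partial_sum X u n.+1 @^-1` A `&` cyl J B =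
    pair @^-1` C `&` (F `&` G).
  by rewrite sumS; apply/seteqP; split => w /=; tauto.
by rewrite H sumS muleAC.
Qed.

Let cyl0 B : cyl fset0 B = setT.
Proof. by rewrite /cyl set_fset0 bigcap_set0. Qed.

Let msum n u A : measurable A -> measurable (partial_sum X u n @^-1` A).
Proof. by move=> mA; exact: measurable_funPTI. Qed.

Lemma indep_sum_next n (u : nat -> K) : injective u ->
  forall A B : set R, measurable A -> measurable B ->
  P ((partial_sum X u n) @^-1` A `&` X (u n) @^-1` B) =
  (P ((partial_sum X u n) @^-1` A) * P (X (u n) @^-1` B))%E.
Proof.
move=> uinj A B mA mB.
have := @indep_sum n u uinj set0 setT measurableT.
move=> /(_ _ _ A [fset u n]%fset (fun=> B) mA (fun=> mB)).
rewrite /cyl set_fset1 bigcap_set1 setTI probability_setT mul1e; apply.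
- by move=> J0 B0 mB0 _; rewrite setTI mul1e.
- by move=> j [].
move=> k; rewrite inE => /eqP ->; split => // j jn; apply/negP => /eqP/uinj e.
by rewrite e ltnn in jn.
Qed.

(** [indep_sum] for [v], where [F] is the event on the [u]-sum and [D] the range of [u]; the
    condition on [F] is [indep_sum] for [u] with the trivial event. *)
Lemma indep_sums_disjoint n m (u v : nat -> K) : injective u -> injective v ->
  (forall i j, u i != v j) ->
  forall A B : set R, measurable A -> measurable B ->
  P ((partial_sum X u n) @^-1` A `&`
     (partial_sum X v m) @^-1` B) =
  (P ((partial_sum X u n) @^-1` A) *
   P ((partial_sum X v m) @^-1` B))%E.
Proof.
move=> uinj vinj uv A B mA mB.
have := @indep_sum m v vinj (range u) _ (msum n u A mA).
move=> /(_ _ _ B fset0 (fun=> setT) mB (fun=> measurableT)).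
rewrite cyl0 setIT probability_setT mule1; apply => //.
  move=> J C mC JD.
  have := @indep_sum n u uinj set0 setT measurableT.
  move=> /(_ _ _ A J C mA mC); rewrite setTI probability_setT mul1e; apply.
  - by move=> J0 B0 mB0 _; rewrite setTI mul1e.
  - by move=> j [].
  move=> k /JD kD; split => // j _; apply/eqP => kj; apply: kD.
  by rewrite kj; exists j.
by move=> j [i _] /eqP; rewrite (negPf (uv _ _)).
Qed.

Lemma ge0_integral_sum_next n (u : nat -> K) (f : R -> \bar R) : injective u ->
  measurable_fun [set: R] f -> (forall x, 0 <= f x)%E ->
  (\int[distribution P (partial_sum X u n.+1)]_x f x =
   \int[distribution P (X (u n))]_y
     \int[distribution P (partial_sum X u n)]_x f (x + y)%R)%E.
Proof.
move=> uinj mf f0; rewrite ge0_integral_distribution//.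
have mD : measurable_fun [set: R * R] (fun z => z.1 + z.2) by exact: measurable_funD.
rewrite -(@ge0_integral_indep _ _ _ _ _ _ (fun z => f (z.1 + z.2)))//.
- by apply: eq_integral => w _; rewrite /= !partial_sumE big_ord_recr.
- exact: indep_sum_next.
- exact: measurableT_comp.
Qed.

Variable nu : probability R R.
Hypothesis law_nu : forall k B, measurable B -> distribution P (X k) B = nu B.

Lemma ge0_integral_sum_next_law n (u : nat -> K) (f : R -> \bar R) : injective u ->
  measurable_fun [set: R] f -> (forall x, 0 <= f x)%E ->
  (\int[distribution P (partial_sum X u n.+1)]_x f x =
   \int[nu]_y
     \int[distribution P (partial_sum X u n)]_x f (x + y)%R)%E.
Proof.
move=> uinj mf f0; rewrite ge0_integral_sum_next//.
by apply: eq_measure_integral => A mA _; exact: law_nu.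
Qed.

(** The recursion for the law of a partial sum involves [nu] but not the enumeration. *)
Lemma distribution_sum_eq n (u v : nat -> K) : injective u -> injective v ->
  forall A, measurable A ->
  distribution P (partial_sum X u n) A =
  distribution P (partial_sum X v n) A.
Proof.
move=> uinj vinj; elim: n => [|n IH] A mA; first by rewrite /partial_sum !big_ord0.
have m1 : measurable_fun [set: R] (fun x : R => (\1_A x)%:E : \bar R).
  by apply/measurable_EFinP/measurable_indic.
rewrite -[A]setIT -!integral_indic// !ge0_integral_sum_next_law//.
apply: eq_integral => y _; apply: eq_measure_integral => B mB _; exact: IH.
Qed.

End independent_sums.

(** * Log-moment generating function *)

Lemma is_derive_expR_mulr (R : realType) (x t : R) :
  is_derive t 1 (fun s => expR (s * x)) (x * expR (t * x)).
Proof.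
have d : is_derive t 1 (fun s => s * x) x.
  have -> : (fun s : R => s * x) = (x \*: id) by apply/funext => s /=; rewrite mulrC.
  by apply: is_derive_eq; rewrite /GRing.scale/= mulr1.
by rewrite mulrC; exact: is_derive1_comp.
Qed.

Section log_moment_generating_function.
Context {R : realType} {d : measure_display} {T : measurableType d}.
Variables (P : probability T R) (X : {RV P >-> R}).
Hypothesis fin_mgf : forall t : R, 0 <= t -> log_mgfe P X t \is a fin_num.

Let phi := log_mgf P X.

(** Finiteness of [lne] excludes both 0 and [+oo] as values of the integral, so [expR] undoes it. *)
Lemma mgfE (t : R) : 0 <= t -> (\int[P]_w (expR (t * X w))%:E = (expR (phi t))%:E)%E.
Proof.
move=> t0; have := fin_mgf _ t0; rewrite /phi /log_mgf /log_mgfe.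
have -> : 'M_P X t = (\int[P]_w (expR (t * X w))%:E)%E.
  rewrite /mmt_gen_fun unlock; apply: eq_integral => w _ /=.
  by rewrite /GRing.mulr_fun mulrC.
case: (integral _ _ _) => [r| |] //=.
by case: ltP => // r0 _ /=; rewrite lnK.
Qed.

Let mexpX (t : R) : measurable_fun [set: T] (fun w => expR (t * X w)).
Proof. by apply: measurableT_comp => //; exact: measurable_funM. Qed.

Let iZ (k : R) (f : T -> R) : P.-integrable [set: T] (EFin \o f) ->
  P.-integrable [set: T] (EFin \o (fun w => k * f w)).
Proof.
have -> : EFin \o (fun w => k * f w) = (fun w => k%:E * (EFin \o f) w)%E.
  by apply/funext => w /=; rewrite EFinM.
exact: integrableZl.
Qed.

Let iD (f g : T -> R) : P.-integrable [set: T] (EFin \o f) ->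
  P.-integrable [set: T] (EFin \o g) ->
  P.-integrable [set: T] (EFin \o (fun w => f w + g w)).
Proof.
have -> : EFin \o (fun w => f w + g w) = ((EFin \o f) \+ (EFin \o g))%E by [].
exact: integrableD.
Qed.

Let iB (f g : T -> R) : P.-integrable [set: T] (EFin \o f) ->
  P.-integrable [set: T] (EFin \o g) ->
  P.-integrable [set: T] (EFin \o (fun w => f w - g w)).
Proof.
have -> : EFin \o (fun w => f w - g w) = ((EFin \o f) \- (EFin \o g))%E by [].
exact: integrableB.
Qed.

Let iexpX (t : R) : 0 <= t -> P.-integrable [set: T] (EFin \o (fun w => expR (t * X w))).
Proof.
move=> t0; apply/integrableP; split; first exact/measurable_EFinP.
under eq_integral do rewrite /= ger0_norm ?expR_ge0//.
by rewrite mgfE// ltry.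
Qed.

(** Domination for differentiating under the integral near [a]. The factor [a / 2 * |x|] is at most
    [expR (a / 2 * x) + expR (- (a / 2 * x))], and the resulting exponents [t + a / 2] and
    [t - a / 2] stay in [[0, 2 * a]], where exponential moments are finite. *)
Let dom_ub (a t x : R) : 0 < a -> a / 2 < t < 3 * a / 2 ->
  `|x * expR (t * x)| <= 4 / a * (1 + expR (2 * a * x)).
Proof.
move=> a0 /andP[t1 t2].
have e2 u : 0 <= u <= 2 * a -> expR (u * x) <= 1 + expR (2 * a * x).
  move=> /andP[u0 u2]; have [x0|x0] := leP 0 x.
    by rewrite ler_wpDl// ler_expR ler_wpM2r.
  by rewrite ler_wpDr ?expR_ge0// -expR0 ler_expR mulr_ge0_le0// ltW.
have h1 : a / 2 * `|x| <= expR (a / 2 * x) + expR (- (a / 2 * x)).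
  have [x0|x0] := leP 0 x.
    rewrite ger0_norm//.
    rewrite ler_wpDr ?expR_ge0//; have := expR_ge1Dx (a / 2 * x); lra.
  rewrite ltr0_norm// mulrN ler_wpDl ?expR_ge0//.
  by have := expR_ge1Dx (- (a / 2 * x)); lra.
rewrite normrM (ger0_norm (expR_ge0 _)).
rewrite mulrAC ler_pdivlMr// -(ler_pM2l (_ : 0 < 1 / 2 :> R))//.
have h2 := ler_wpM2r (expR_ge0 (t * x)) h1.
have h3 := e2 (a / 2 + t); have h4 := e2 (t - a / 2).
have {}h3 : expR ((a / 2 + t) * x) <= 1 + expR (2 * a * x) by apply: h3; lra.
have {}h4 : expR ((t - a / 2) * x) <= 1 + expR (2 * a * x) by apply: h4; lra.
move: h2; rewrite mulrDl -!expRD -mulrDl.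
have -> : - (a / 2 * x) + t * x = (t - a / 2) * x by ring.
by move: h3 h4; lra.
Qed.

(** Mean of [X] under the law tilted by [expR (a * X)]. *)
Let m (a : R) := (\int[P]_w (X w * expR (a * X w)) / expR (phi a))%R.

Let iXexp (a : R) : 0 < a ->
  P.-integrable [set: T] (EFin \o (fun w => X w * expR (a * X w))).
Proof.
move=> a0; apply: (@le_integrable _ _ _ P setT measurableT _
   (EFin \o (fun w => 4 / a * (1 + expR (2 * a * X w))))).
- by apply/measurable_EFinP/measurable_funM.
- move=> w _; rewrite /= lee_fin [leRHS]ger0_norm ?dom_ub//; first last.
    by rewrite mulr_ge0 ?divr_ge0 ?addr_ge0 ?expR_ge0// ltW.
  by apply/andP; split; lra.
- apply: iZ; apply: iD; last by apply: iexpX; lra.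
  exact: finite_measure_integrable_cst.
Qed.

Lemma is_derive_log_mgf (a : R) : 0 < a -> is_derive a 1 phi (m a).
Proof.
move=> a0.
have Ia : `]a / 2, (3 * a / 2)[%classic a by rewrite /= in_itv/=; lra.
pose f (t : R) w := expR (t * X w).
pose F t := (\int[P]_w f t w)%R.
have FE t : 0 <= t -> F t = expR (phi t).
  by move=> t0; rewrite /F /Rintegral mgfE.
have d1 t w : partial1of2 f t w = X w * expR (t * X w).
  rewrite partial1of2E; exact: (@derive_val _ _ _ _ _ _ _ (is_derive_expR_mulr R (X w) t)).
have dF : h^-1 *: (F (h + a) - F a) @[h --> 0^'] --> (\int[P]_w (X w * expR (a * X w)))%R.
  have := @cvg_differentiation_under_integral R _ T P f setT measurableT a _ _ Ia
    _ _ (fun w => 4 / a * (1 + expR (2 * a * X w))) _ _ _.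
  rewrite (_ : (\int[P]_w partial1of2 f a w)%R = (\int[P]_w (X w * expR (a * X w)))%R).
    apply.
    - by move=> t; rewrite /= in_itv/= => /andP[t1 _]; apply: iexpX; lra.
    - by move=> t w _ _; have [] := is_derive_expR_mulr R (X w) t.
    - by move=> w; rewrite mulr_ge0 ?divr_ge0 ?addr_ge0 ?expR_ge0// ltW.
    - apply: iZ; apply: iD; last by apply: iexpX; lra.
      exact: finite_measure_integrable_cst.
    - by move=> t w; rewrite /= in_itv/= => It _; rewrite d1; exact: dom_ub.
  by apply: eq_Rintegral => w _; rewrite d1.
have isF : is_derive a 1 F (\int[P]_w (X w * expR (a * X w)))%R.
  have e : (fun h : R => h^-1 *: ((F \o shift a) (h *: (1 : R)) - F a)) =
           (fun h => h^-1 *: (F (h + a) - F a)).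
    by apply/funext => h; rewrite /= /GRing.scale/= mulr1.
  apply: DeriveDef; first by rewrite /derivable e; apply/cvg_ex; eexists; exact: dF.
  by rewrite /derive e; exact/cvg_lim.
(* [F t = expR (phi t)] is known for [t >= 0] only, so the two functions are compared near [a]. *)
apply: (@near_eq_is_derive _ _ _ (@ln R \o F)).
  near=> t; rewrite /= FE ?expRK//.
  by apply: ltW; near: t; exact: lt_nbhsr.
rewrite /m mulrC -FE ?(ltW a0)//; apply: is_derive1_comp.
by apply: is_derive1_ln; rewrite FE ?expR_gt0// ltW.
Unshelve. all: by end_near. Qed.

Lemma derive1_log_mgf (a : R) : 0 < a -> phi^`()%classic a = m a.
Proof.
move=> a0; rewrite derive1E.
exact: (@derive_val _ _ _ _ _ _ _ (is_derive_log_mgf a a0)).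
Qed.

Hypothesis X_nondegenerate : nondegenerate_RV P X.

(** Strict convexity comes from [1 + u <= expR u] at [u = (t - a) * (X - mu)], integrated against
    [expR (a * X)]. If the conclusion failed, the nonnegative difference [g] would have integral 0,
    which forces [X = mu] almost surely. *)
Lemma log_mgf_gt_tangent (a t : R) : 0 < a -> 0 <= t -> t != a ->
  phi a + phi^`()%classic a * (t - a) < phi t.
Proof.
move=> a0 t0 ta; rewrite derive1_log_mgf// ltNge; apply/negP => tangent.
set mu := m a.
pose k : R := expR ((t - a) * mu).
pose g w := expR (t * X w) -
  k * (expR (a * X w) + (t - a) * (X w * expR (a * X w) - mu * expR (a * X w))).
have gE w : g w = k * expR (a * X w) *
    (expR ((t - a) * (X w - mu)) - (1 + (t - a) * (X w - mu))).
  rewrite /g /k.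
  have -> : expR (t * X w) =
      expR ((t - a) * mu) * expR (a * X w) * expR ((t - a) * (X w - mu)).
    by rewrite -!expRD; congr expR; ring.
  by ring.
have g0 w : 0 <= g w.
  by rewrite gE !mulr_ge0 ?expR_ge0// subr_ge0 expR_ge1Dx.
have i1 := iexpX _ (ltW a0); have i2 := iXexp _ a0; have i3 := iexpX _ t0.
have i4 : P.-integrable [set: T] (EFin \o (fun w => mu * expR (a * X w))).
  exact: iZ.
have i5 : P.-integrable [set: T]
   (EFin \o (fun w => X w * expR (a * X w) - mu * expR (a * X w))).
  exact: iB.
have i6 : P.-integrable [set: T]
   (EFin \o (fun w => (t - a) * (X w * expR (a * X w) - mu * expR (a * X w)))).
  exact: iZ.
have i7 : P.-integrable [set: T] (EFin \o (fun w => expR (a * X w) +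
    (t - a) * (X w * expR (a * X w) - mu * expR (a * X w)))).
  exact: iD.
have i8 : P.-integrable [set: T] (EFin \o (fun w => k * (expR (a * X w) +
    (t - a) * (X w * expR (a * X w) - mu * expR (a * X w))))).
  exact: iZ.
have ig : P.-integrable [set: T] (EFin \o g) by exact: iB.
have FE s : 0 <= s -> (\int[P]_w expR (s * X w))%R = expR (phi s).
  by move=> s0; rewrite /Rintegral mgfE.
(* The linear term integrates to 0 because [mu] is the tilted mean. *)
have intg : (\int[P]_w g w)%R = expR (phi t) - k * expR (phi a).
  rewrite RintegralB// RintegralZl// RintegralD// RintegralZl// RintegralB//.
  rewrite RintegralZl// !FE ?(ltW a0)// /mu /m.
  by rewrite divfK ?gt_eqF ?expR_gt0// subrr mulr0 addr0.
have intg0 : (\int[P]_w g w)%R = 0.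
  apply/eqP; rewrite eq_le Rintegral_ge0// andbT intg subr_le0 /k -expRD ler_expR.
  by move: tangent; rewrite -/mu; lra.
have eg : (\int[P]_w `|(g w)%:E| = 0)%E.
  under eq_integral do rewrite gee0_abs ?lee_fin//.
  by rewrite -(fineK (integrable_fin_num measurableT ig)) -/(Rintegral _ _ _) intg0.
have mg : measurable_fun [set: T] (EFin \o g) by case/integrableP : ig.
move/(ae_eq_integral_abs _ measurableT mg) : eg => eg.
apply: X_nondegenerate; exists mu; apply: filterS eg => w /(_ I)/= [gw].
apply/eqP/negPn/negP => Xmu; move: gw; rewrite gE => /eqP.
rewrite mulf_eq0 gt_eqF ?mulr_gt0 ?expR_gt0//= gt_eqF//.
by rewrite subr_gt0 expR_gt1Dx// mulf_neq0// subr_eq0.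
Qed.

End log_moment_generating_function.

(** * Consequences of strict convexity for the rate function *)

Section strict_tangent.
Context {R : realType}.
Variable phi : R -> R.
Hypothesis phi_gt_tangent : forall a t : R, 0 < a -> 0 <= t -> t != a ->
  phi a + phi^`()%classic a * (t - a) < phi t.

(** As [phi] lies above its tangent at [a], the supremum is attained at [t = a]. *)
Lemma rate_derive1 (a : R) : 0 < a ->
  rate phi (phi^`()%classic a) = (a * phi^`()%classic a - phi a)%:E.
Proof.
move=> a0; apply/eqP; rewrite eq_le; apply/andP; split; last first.
  by apply: ereal_sup_ubound; exists a; rewrite /= ?(ltW a0)// mulrC.
apply: ge_ereal_sup => _ [t /= t0 <-]; rewrite lee_fin.
have [->|ta] := eqVneq t a; first by rewrite mulrC.
by have := phi_gt_tangent a t a0 t0 ta; lra.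
Qed.

(** The tangent at [b] bounds the right side below by [a * phi' b - phi a], and adding the tangents
    at [a] and [b] gives [phi' a < phi' b]. *)
Lemma rate_derive1_lt (a b : R) : 0 < a -> a < b ->
  a * phi^`()%classic a - phi a < b * phi^`()%classic b - phi b.
Proof.
move=> a0 ab; have b0 : 0 < b by lra.
have h1 := phi_gt_tangent a b a0 (ltW b0) (negbT (gt_eqF ab)).
have h2 := phi_gt_tangent b a b0 (ltW a0) (negbT (lt_eqF ab)).
have : 0 < (b - a) * (phi^`()%classic b - phi^`()%classic a) by lra.
by rewrite pmulr_rgt0 ?subr_gt0// => h3; nra.
Qed.

End strict_tangent.

(** * Atoms of a nondegenerate lattice law *)

Section lattice_atoms.
Context {R : realType} {d : measure_display} {T : measurableType d}.
Variables (P : probability T R) (X : {RV P >-> R}) (h : R).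
Hypothesis X_lattice : on_lattice P X h.

(** The lattice is countable, so off [a] it is covered by countably many null events, enumerated
    here by [unpickle]. *)
Let ae_eq_of_no_atom (a : R) : (forall b, b != a -> P (X @^-1` [set b]) = 0) ->
  {ae P, forall w, X w = a}.
Proof.
move=> noatom.
pose F n : set T := match choice.unpickle n : option int with
  | Some k => if h * k%:~R == a then set0 else X @^-1` [set h * k%:~R]
  | None => set0 end.
have nF : P.-negligible (\bigcup_n F n).
  apply: negligible_bigcup => n; rewrite /F.
  case: (choice.unpickle n : option int) => [k|]; last exact: negligible_set0.
  case: ifPn => [_|ka]; first exact: negligible_set0.
  apply/negligibleP; last exact: noatom.
  by apply: measurable_funPTI.
have := negligibleU X_lattice nF; apply: negligibleS => w /= Xa.
have [[k Xk]|nk] := pselect (exists k : int, X w = h * k%:~R); last by left.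
right; exists (choice.pickle k) => //; rewrite /F choice.pickleK.
by case: eqP => [ka|_] //=; exfalso; apply: Xa; rewrite Xk.
Qed.

Lemma lattice_two_atoms : nondegenerate_RV P X ->
  exists a b : R, [/\ a != b, (0 < P (X @^-1` [set a]))%E &
    (0 < P (X @^-1` [set b]))%E].
Proof.
move=> ndg.
have other a : exists2 b, b != a & (0 < P (X @^-1` [set b]))%E.
  apply: contrapT => noatom; apply: ndg; exists a.
  apply: ae_eq_of_no_atom => b ba; apply/eqP; rewrite eq_le measure_ge0 andbT leNgt.
  by apply/negP => Pb; apply: noatom; exists b.
have [a _ Pa] := other 0; have [b ba Pb] := other a.
by exists a, b; split => //; rewrite eq_sym.
Qed.

End lattice_atoms.

(** * Variance of a sum of uncorrelated variables *)

Section pairwise_uncorrelated.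
Context {R : realType} {d : measure_display} {T : measurableType d}.
Variables (P : probability T R) (Y : nat -> {RV P >-> R}).
Hypothesis Y2 : forall i, (Y i : T -> R) \in Lfun P 2%:E.
Hypothesis cov0 : forall i j, i != j -> covariance P (Y i) (Y j) = 0%E.

Let sum2 n : (fun w => \sum_(i < n) Y i w) \in Lfun P 2%:E.
Proof.
elim: n => [|n IH].
  by under eq_fun do rewrite big_ord0; exact: Lfun_cst.
have -> : (fun w => \sum_(i < n.+1) Y i w) = (fun w => \sum_(i < n) Y i w) + Y n.
  by apply/funext => w; rewrite big_ord_recr.
by rewrite rpredD ?lee1n//=.
Qed.

Let cov_sum n m : (n <= m)%N -> covariance P (fun w => \sum_(i < n) Y i w) (Y m) = 0%E.
Proof.
elim: n => [|n IH] nm.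
  by under eq_fun do rewrite big_ord0; exact: covariance_cst_l.
have -> : (fun w => \sum_(i < n.+1) Y i w) = (fun w => \sum_(i < n) Y i w) \+ Y n.
  by apply/funext => w; rewrite big_ord_recr.
rewrite covarianceDl ?sum2 ?Y2//.
by rewrite IH ?(ltnW nm)// add0e cov0// ltn_eqF.
Qed.

Lemma variance_sum_uncorrelated n :
  ('V_P[fun w => (\sum_(i < n) Y i w)%R] = \sum_(i < n) 'V_P[Y i])%E.
Proof.
elim: n => [|n IH].
  by rewrite big_ord0; under [X in 'V_P[X]]eq_fun do rewrite big_ord0; exact: variance_cst.
have -> : (fun w => \sum_(i < n.+1) Y i w) = (fun w => \sum_(i < n) Y i w) \+ Y n.
  by apply/funext => w; rewrite big_ord_recr.
rewrite varianceD ?sum2 ?Y2//.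
by rewrite IH cov_sum// mule0 adde0 big_ord_recr.
Qed.

End pairwise_uncorrelated.

Lemma bounded_Lfun2 (R : realType) d (T : measurableType d) (P : probability T R)
    (Y : {RV P >-> R}) (B : R) : (forall w, 0 <= Y w <= B) ->
  (Y : T -> R) \in Lfun P 2%:E.
Proof.
move=> YB; rewrite inE; apply/andP; split; rewrite inE/=; first exact: measurable_funPT.
rewrite /finite_norm unlock poweR_lty//.
apply: (@le_lt_trans _ _ (\int[P]_w cst (B `^ 2)%:E w)%E).
  apply: ge0_le_integral => //.
  - by move=> w _; exact: poweR_ge0.
  - apply: (measurableT_comp (measurable_poweR _)).
    by apply: measurableT_comp => //; exact/measurable_EFinP.
  move=> w _; have /andP[Y0 YwB] := YB w.
  by rewrite /= lee_fin ger0_norm// ge0_ler_powR// nnegrE (le_trans Y0).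
by apply/integrable_lty => //; exact: finite_measure_integrable_cst.
Qed.

(** * Row sums of the array *)

Section rows.
Context {R : realType} {d0 d : measure_display}
  {T0 : measurableType d0} {T : measurableType d}.
Variables (P0 : probability T0 R) (X : {RV P0 >-> R}).
Hypothesis fin_mgf : forall t : R, 0 <= t -> log_mgfe P0 X t \is a fin_num.
Variables (P : probability T R) (Xs : nat -> nat -> {RV P >-> R}).
Hypothesis Xs_indep : mutually_independent P (fun k : nat * nat => Xs k.1 k.2).
Hypothesis Xs_copies : forall i j, is_copy P P0 (Xs i j) X.

Let phi := log_mgf P0 X.

Definition row_sum (i n : nat) : {RV P >-> R} :=
  partial_sum (fun k : nat * nat => Xs k.1 k.2) (fun j => (i, j)) n.

Lemma row_sumE i n w : row_sum i n w = \sum_(j < n) Xs i j w.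
Proof. exact: partial_sumE. Qed.

Let pair_inj (i : nat) : injective (fun j : nat => (i, j)).
Proof. by move=> j k []. Qed.

(** Row 0 represents all rows, which have the same law by [ge0_integral_row_sum]. *)
Definition row_sum_law n : probability R R := distribution P (row_sum 0 n).

Lemma ge0_integral_row_sum i n (f : R -> \bar R) : measurable_fun [set: R] f ->
  (forall x, 0 <= f x)%E ->
  (\int[P]_w f (row_sum i n w) = \int[row_sum_law n]_x f x)%E.
Proof.
move=> mf f0; rewrite -(ge0_integral_distribution (row_sum i n))//.
apply: eq_measure_integral => A mA _.
apply: (@distribution_sum_eq _ _ _ _ _ _ Xs_indep (distribution P0 X)) => //.
by move=> k; exact: Xs_copies.
Qed.

Lemma row_sum_law0 (f : R -> \bar R) : measurable_fun [set: R] f ->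
  (forall x, 0 <= f x)%E -> (\int[row_sum_law 0]_x f x = f 0%R)%E.
Proof.
move=> mf f0; rewrite -(ge0_integral_row_sum 0)//.
under eq_integral do rewrite row_sumE big_ord0.
by rewrite (integral_cst _ measurableT)/= probability_setT mule1.
Qed.

Lemma row_sum_lawS n (f : R -> \bar R) : measurable_fun [set: R] f ->
  (forall x, 0 <= f x)%E ->
  (\int[row_sum_law n.+1]_x f x =
   \int[distribution P0 X]_y \int[row_sum_law n]_x f (x + y)%R)%E.
Proof.
move=> mf f0; apply: (@ge0_integral_sum_next_law _ _ _ _ _ _ Xs_indep) => //.
by move=> k; exact: Xs_copies.
Qed.

Lemma row_sum_indep n i j (f g : R -> R) : i != j ->
  measurable_fun [set: R] f -> measurable_fun [set: R] g ->
  (forall x, 0 <= f x) -> (forall x, 0 <= g x) ->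
  (\int[P]_w (f (row_sum i n w) * g (row_sum j n w))%:E =
   \int[row_sum_law n]_x (f x)%:E * \int[row_sum_law n]_x (g x)%:E)%E.
Proof.
move=> ij mf mg f0 g0.
have mf' : measurable_fun [set: R] (fun x => (f x)%:E) by exact/measurable_EFinP.
have mg' : measurable_fun [set: R] (fun x => (g x)%:E) by exact/measurable_EFinP.
have f0' x : [set: R] x -> (0 <= (f x)%:E)%E by rewrite lee_fin.
have g0' x : [set: R] x -> (0 <= (g x)%:E)%E by rewrite lee_fin.
rewrite (@ge0_integral_indep _ _ _ P (row_sum i n) (row_sum j n)
  (fun z => (f z.1 * g z.2)%:E)); last 3 first.
- apply: indep_sums_disjoint => //.
  by move=> k l; apply/eqP => -[e]; rewrite e eqxx in ij.
- by apply/measurable_EFinP/measurable_funM; apply: measurableT_comp.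
- by move=> z; rewrite lee_fin mulr_ge0.
have law k (u : R -> R) : measurable_fun [set: R] u -> (forall x, 0 <= u x) ->
    (\int[distribution P (row_sum k n)]_x (u x)%:E = \int[row_sum_law n]_x (u x)%:E)%E.
  move=> mu u0; rewrite ge0_integral_distribution//; last exact/measurable_EFinP.
  rewrite -(ge0_integral_row_sum k)//; exact/measurable_EFinP.
transitivity (\int[distribution P (row_sum j n)]_y
   ((\int[row_sum_law n]_x (f x)%:E) * (g y)%:E))%E.
  apply: eq_integral => y _ /=; under eq_integral do rewrite mulrC EFinM.
  by rewrite ge0_integralZl// ?lee_fin// law// muleC.
rewrite ge0_integralZl//; last by apply: integral_ge0.
by rewrite law.
Qed.

Let mexpM (t : R) : measurable_fun [set: R] (fun x : R => (expR (t * x))%:E).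
Proof. by apply/measurable_EFinP/measurableT_comp => //; exact: measurable_funM. Qed.

Lemma distribution_mgf (t : R) : 0 <= t ->
  (\int[distribution P0 X]_y (expR (t * y))%:E = (expR (phi t))%:E)%E.
Proof.
by move=> t0; rewrite ge0_integral_distribution//= mgfE.
Qed.

Lemma row_sum_mgf (t : R) n : 0 <= t ->
  (\int[row_sum_law n]_x (expR (t * x))%:E = (expR (phi t * n%:R))%:E)%E.
Proof.
move=> t0; elim: n => [|n IH].
  by rewrite row_sum_law0 ?mulr0 ?expR0// => x; rewrite lee_fin expR_ge0.
rewrite row_sum_lawS//.
transitivity (\int[distribution P0 X]_y
    ((expR (phi t * n%:R))%:E * (expR (t * y))%:E))%E.
  apply: eq_integral => y _; rewrite -IH.
  under eq_integral do rewrite mulrDr expRD mulrC EFinM.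
  by rewrite ge0_integralZl// 1?muleC.
rewrite ge0_integralZl// ?lee_fin ?expR_ge0//.
by rewrite distribution_mgf// -EFinM -expRD -natr1 mulrDr mulr1.
Qed.

Variables (h : R).
Hypothesis X_nondegenerate : nondegenerate_RV P0 X.
Hypothesis X_lattice : on_lattice P0 X h.
Variable alpha : R.
Hypothesis alpha_gt0 : 0 < alpha.

(** [tilted_power_le] for the law of [X], with the two atoms from [lattice_two_atoms]; [C] does not
    depend on [t] because the coin-flip bound does not. *)
Lemma tilted_row_sum_le (kappa : R) : 0 < kappa ->
  exists2 C, 0 < C & forall n t,
    (\int[row_sum_law n]_x (expR (alpha * x - kappa * `|x - t|))%:E <=
      (C * (expR (phi alpha * n%:R) / Num.sqrt n.+1%:R))%:E)%E.
Proof.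
move=> k0.
have [a [b [ab Pa Pb]]] := lattice_two_atoms P0 X h X_lattice X_nondegenerate.
have [K K0 HK] := iter_two_point_mean_le R a b kappa k0 ab.
pose p y := fine (P0 (X @^-1` [set y])).
have pE y : (p y)%:E = P0 (X @^-1` [set y]).
  by rewrite fineK// fin_num_measure//; exact: measurable_funPTI.
have pa : 0 < p a by rewrite -lte_fin pE.
have pb : 0 < p b by rewrite -lte_fin pE.
pose M := expR (phi alpha).
have M0 : 0 < M by exact: expR_gt0.
(* The smaller of the two tilted atom masses, normalised by [M]. *)
pose r := Num.min (expR (alpha * a) * p a) (expR (alpha * b) * p b) / M.
have r0 : 0 < r by rewrite divr_gt0// lt_min !mulr_gt0 ?expR_gt0.
have rM y : y \in [:: a; b] ->
    ((r * M)%:E <= (expR (alpha * y))%:E * distribution P0 X [set y])%E.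
  rewrite /r divfK ?gt_eqF// /distribution /pushforward -pE -EFinM lee_fin.
  by rewrite !inE => /orP[/eqP ->|/eqP ->]; rewrite ge_min lexx ?orbT.
exists (K / Num.sqrt (r / 2)); first by rewrite divr_gt0// sqrtr_gt0 divr_gt0.
move=> n t.
pose g (x : R) := expR (- (kappa * `|x - t|)).
have mg : measurable_fun [set: R] g.
  apply: measurableT_comp => //; apply: measurableT_comp => //.
  apply: measurable_funM => //; apply: measurableT_comp => //.
  exact: measurable_funB.
have := @tilted_power_le R (distribution P0 X) row_sum_law row_sum_law0 row_sum_lawS
  alpha M (distribution_mgf _ (ltW alpha_gt0)) a b r ab M0 r0 rM K g mg
  (fun x => expR_ge0 _) (HK t) n.
under eq_integral do rewrite -expRD.
by rewrite /M -expRM_natr mulrA.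
Qed.

End rows.

(** * Truncated exponential and size of the scaling *)

Definition truncated_exp {R : realType} (t x : R) : R :=
  expR x * \1_(`]-oo, t]%classic) x.

Lemma truncated_expE (R : realType) (t x : R) :
  truncated_exp t x = if x <= t then expR x else 0.
Proof.
rewrite /truncated_exp indicE; have [xt|xt] := leP x t.
  by rewrite mem_set ?mulr1//= in_itv.
by rewrite memNset ?mulr0//= in_itv/=; apply/negP; rewrite -ltNge.
Qed.

Lemma measurable_truncated_exp (R : realType) (t : R) :
  measurable_fun [set: R] (truncated_exp t).
Proof. by apply: measurable_funM => //; exact: measurable_indic. Qed.

HB.instance Definition _ (R : realType) (t : R) :=
  isMeasurableFun.Build _ _ _ _ (truncated_exp t) (measurable_truncated_exp R t).

Lemma truncated_exp_ge0 (R : realType) (t x : R) : 0 <= truncated_exp t x.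
Proof. by rewrite truncated_expE; case: ifP => // _; exact: expR_ge0. Qed.

Lemma truncated_exp_le (R : realType) (t x : R) : truncated_exp t x <= expR t.
Proof. by rewrite truncated_expE; case: ifP => [xt|_]; rewrite ?ler_expR ?expR_ge0. Qed.

(** When [phi^`(2) alpha <= 0] the square root is [0] and [ln 0 = 0], which only
    makes the scaling larger: positivity of the second derivative is not needed. *)
Lemma log_scaling_lower (R : realType) (phi : R -> R) (alpha h : R) :
  0 < alpha -> 0 < h -> exists2 C, 0 < C & forall n : nat,
    expR (alpha * phi^`()%classic alpha * n%:R) / Num.sqrt n.+1%:R <=
      C * expR (alpha * log_scaling phi alpha h n).
Proof.
move=> a0 h0; set s := 2 * pi * phi^`(2)%classic alpha.
(* The summand 1 serves the case [y <= 0], including [n = 0], where [expR (ln y) = 1]. *)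
pose C := 1 + h^-1 * Num.sqrt `|s|.
have hs0 : 0 <= h^-1 * Num.sqrt `|s| by rewrite mulr_ge0 ?sqrtr_ge0// invr_ge0 ltW.
have C1 : 1 <= C by rewrite lerDl.
exists C => [|n]; first exact: lt_le_trans C1.
set y := h^-1 * Num.sqrt (s * n%:R).
have sq1 : 1 <= Num.sqrt n.+1%:R :> R by rewrite -[leLHS]sqrtr1 ler_wsqrtr// ler1n.
have sq0 : 0 < Num.sqrt n.+1%:R :> R by exact: lt_le_trans sq1.
have ylnC : expR (ln y) <= C * Num.sqrt n.+1%:R.
  have [y0|y0] := ltP 0 y; last first.
    by rewrite ln0// expR0 -[leLHS]mulr1 ler_pM.
  rewrite lnK ?posrE// /y /C mulrDl ler_wpDl ?mul1r ?(ltW sq0)//.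
  rewrite -mulrA ler_pM2l ?invr_gt0// -sqrtrM// ler_wsqrtr//.
  apply: (@le_trans _ _ (`|s| * n%:R)); first by rewrite ler_wpM2r// ler_norm.
  by rewrite ler_wpM2l// ler_nat.
rewrite /log_scaling -/s -/y mulrBr mulrA (mulrA alpha alpha^-1) divff ?gt_eqF//.
rewrite mul1r expRD expRN mulrCA ler_pM2l ?expR_gt0//.
by rewrite -[leLHS]mul1r ler_pdivrMr// mulrAC ler_pdivlMr ?expR_gt0// mul1r.
Qed.

(** * Truncation and tightness *)

Section tightness.
Context {R : realType} {d0 d : measure_display}
  {T0 : measurableType d0} {T : measurableType d}.
Variables (P0 : probability T0 R) (X : {RV P0 >-> R}).
Variables (P : probability T R) (Xs : nat -> nat -> {RV P >-> R}).
Hypothesis Xs_indep : mutually_independent P (fun k : nat * nat => Xs k.1 k.2).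
Hypothesis Xs_copies : forall i j, is_copy P P0 (Xs i j) X.

Let Q := row_sum_law P Xs.
Let S := row_sum P Xs.

Let integral_row_sum i n (f : R -> R) : measurable_fun [set: R] f -> (forall x, 0 <= f x) ->
  (\int[P]_w (f (S i n w))%:E = \int[Q n]_x (f x)%:E)%E.
Proof.
move=> mf f0; rewrite -(@ge0_integral_row_sum _ _ _ _ _ P0 X P Xs _ _ i n (fun x => (f x)%:E))//.
exact/measurable_EFinP.
Qed.

Let sum_const n (x : \bar R) : (0 <= x)%E -> (\sum_(i < n) x = n%:R%:E * x)%E.
Proof.
move=> x0; elim: n => [|n IH]; first by rewrite big_ord0 mul0e.
by rewrite big_ord_recr IH/= -natr1 EFinD ge0_muleDl ?lee_fin// mul1e.
Qed.

Variables (N : nat -> nat) (alpha : R) (b A : nat -> R).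
Hypotheses (alpha_gt0 : 0 < alpha) (alpha_lt2 : alpha < 2).
(** This and the next hypothesis are established in the section [scaling]. Both [t] and [q] are free
    since they vary with [n] in the applications. *)
Hypothesis scaled_row_sum_le : forall kappa, 0 < kappa ->
  exists2 C, 0 < C & forall n t q (u : R -> R), measurable_fun [set: R] u ->
    (forall x, 0 <= u x <= expR (q + alpha * x - kappa * `|x - t|)) ->
    ((N n)%:R%:E * \int[Q n]_x (u x)%:E <= (C * expR (q + alpha * b n))%:E)%E.
Hypothesis centering_le : forall s, 0 <= s -> exists K, forall n,
  `|(N n)%:R * fine (\int[Q n]_x (truncated_exp (b n + s) x)%:E)%E - A n|
    <= K * expR (b n).

Let Y t n i : {RV P >-> R} := (truncated_exp t \o S i n).

Let YE t n i w : Y t n i w = truncated_exp t (S i n w).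
Proof. by []. Qed.

Let Y_Lfun2 t n i : (Y t n i : T -> R) \in Lfun P 2%:E.
Proof.
apply: (@bounded_Lfun2 _ _ _ _ _ (expR t)) => w.
by rewrite YE truncated_exp_ge0 truncated_exp_le.
Qed.

Let Y_Lfun1 t n i : (Y t n i : T -> R) \in Lfun P 1.
Proof. by apply: Lfun_subset12 => //; rewrite fin_num_measure. Qed.

Let mY2 t : measurable_fun [set: R] (fun x => truncated_exp t x ^+ 2).
Proof. exact: measurable_funX. Qed.

Let expectation_Y t n i : 'E_P[Y t n i]%E = (\int[Q n]_x (truncated_exp t x)%:E)%E.
Proof.
rewrite unlock; under eq_integral do rewrite YE.
by rewrite integral_row_sum// => x; exact: truncated_exp_ge0.
Qed.

Let cov_Y t n i j : i != j -> covariance P (Y t n i) (Y t n j) = 0%E.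
Proof.
move=> ij; rewrite covarianceE ?Y_Lfun1//; last first.
  by apply: Lfun2_mul_Lfun1; exact: Y_Lfun2.
rewrite !expectation_Y unlock.
under eq_integral do rewrite /=.
rewrite (@row_sum_indep _ _ _ _ _ P0 X P Xs _ _ n i j (truncated_exp t) (truncated_exp t))//.
- rewrite subee//.
  have := expectation_fin_num (Y_Lfun1 t n 0); rewrite expectation_Y => fin.
  by rewrite fin_numM.
- by move=> x; exact: truncated_exp_ge0.
- by move=> x; exact: truncated_exp_ge0.
Qed.

Let W t n : {RV P >-> R} := \sum_(i < N n) Y t n i.

Let WE t n : (W t n : T -> R) = (fun w => \sum_(i < N n) Y t n i w).
Proof. by apply/funext => w; rewrite mfun_sum. Qed.

Let expectation_W t n : 'E_P[W t n]%E =
  ((N n)%:R * fine (\int[Q n]_x (truncated_exp t x)%:E)%E)%:E.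
Proof.
rewrite unlock WE.
under eq_integral do rewrite -sumEFin.
rewrite ge0_integral_sum//; last 2 first.
- by move=> i; exact/measurable_EFinP.
- by move=> i w _; rewrite lee_fin YE truncated_exp_ge0.
rewrite EFinM fineK; last by rewrite -(expectation_Y t n 0) expectation_fin_num ?Y_Lfun1.
have e i : (\int[P]_w (Y t n i w)%:E = \int[Q n]_x (truncated_exp t x)%:E)%E.
  by rewrite -(expectation_Y t n i) unlock.
under eq_bigr do rewrite e.
by apply: sum_const; apply: integral_ge0 => x _; rewrite lee_fin truncated_exp_ge0.
Qed.

Let variance_W t n :
  ('V_P[W t n] <= (N n)%:R%:E * \int[Q n]_x (truncated_exp t x ^+ 2)%:E)%E.
Proof.
rewrite WE variance_sum_uncorrelated; [|by move=> i; exact: Y_Lfun2|exact: cov_Y].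
have e i : ('V_P[Y t n i] <= \int[Q n]_x (truncated_exp t x ^+ 2)%:E)%E.
  rewrite varianceE ?Y_Lfun2//.
  rewrite -(integral_row_sum i n (fun x => truncated_exp t x ^+ 2)); last 2 first.
  - exact: mY2.
  - by move=> x; rewrite sqr_ge0.
  have -> : 'E_P[(Y t n i ^+ 2)%R]%E =
      (\int[P]_w (truncated_exp t (S i n w) ^+ 2)%:E)%E by rewrite unlock.
  by rewrite geeDl// oppe_le0 sqre_ge0.
apply: (@le_trans _ _ (\sum_(i < N n) \int[Q n]_x (truncated_exp t x ^+ 2)%:E)%E).
  by apply: lee_sum => i _; exact: e.
by rewrite sum_const//; apply: integral_ge0 => x _; rewrite lee_fin sqr_ge0.
Qed.

(** Off [E1] no row sum exceeds [t], so the sum equals its truncation [W]; off [E2], [W] is near its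
    mean, which [centering_le] places near [A n]. First [s] is chosen to control [E1], then [L],
    depending on [s], to control [E2]. *)
Lemma tight_normalized_sumexp :
  tight P (fun n w => (sumexp Xs N n w - A n) / expR (b n)).
Proof.
move=> eps eps0.
have [C1 C10 HC1] := scaled_row_sum_le _ alpha_gt0.
have a20 : 0 < 2 - alpha by rewrite subr_gt0.
have [C2 C20 HC2] := scaled_row_sum_le _ a20.
(* Solves [C1 * expR (- (alpha * s)) <= eps / 2]; the added 1 makes [s] nonnegative. *)
pose s := ln (1 + 2 * C1 / eps) / alpha.
have v0 : 0 < 2 * C1 / eps by rewrite divr_gt0// mulr_gt0.
have s0 : 0 <= s by rewrite divr_ge0 ?(ltW alpha_gt0)// ln_ge0// lerDl ltW.
have es : C1 * expR (- (alpha * s)) <= eps / 2.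
  rewrite /s mulrCA divff ?gt_eqF// mulr1 expRN lnK ?posrE ?addr_gt0//.
  rewrite ler_pdivrMr ?addr_gt0// mulrDr mulr1 mulrA.
  have -> : eps / 2 * (2 * C1) / eps = C1 by field; rewrite gt_eqF.
  by rewrite ler_wpDl// divr_ge0// ltW.
have [K HK] := centering_le s s0.
pose V := C2 * expR ((2 - alpha) * s).
have V0 : 0 < V by rewrite mulr_gt0// expR_gt0.
(* Solves [V / L ^+ 2 <= eps / 2]; the added 1 gives [L <= L ^+ 2]. *)
pose L := 1 + 2 * V / eps.
have LV0 : 0 < 2 * V / eps by rewrite divr_gt0// mulr_gt0.
have L1 : 1 <= L by rewrite lerDl ltW.
have L0 : 0 < L by exact: lt_le_trans L1.
have LV : V / L ^+ 2 <= eps / 2.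
  rewrite ler_pdivrMr ?exprn_gt0//.
  apply: (@le_trans _ _ (eps / 2 * L)); last first.
    by rewrite ler_wpM2l ?divr_ge0 ?(ltW eps0)// expr2 ler_peMl// ltW.
  rewrite /L mulrDr mulr1 mulrA.
  have -> : eps / 2 * (2 * V) / eps = V by field; rewrite gt_eqF.
  by rewrite ler_wpDl// divr_ge0// ltW.
exists (K + L) => n.
pose t := b n + s.
pose E1 := \big[setU/set0]_(i < N n) [set w | t < S i n w].
pose tau := (N n)%:R * fine (\int[Q n]_x (truncated_exp t x)%:E)%E.
pose E2 := [set w | L * expR (b n) <= `|W t n w - fine 'E_P[W t n]%E|].
have mgt i : measurable [set w | t < S i n w].
  have -> : [set w | t < S i n w] = S i n @^-1` `]t, +oo[%classic.
    by apply/seteqP; split => w /=; rewrite in_itv/= andbT.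
  exact: measurable_funPTI.
have mE1 : measurable E1 by apply: bigsetU_measurable => i _; exact: mgt.
have mW : measurable_fun [set: T] (fun w => `|W t n w - fine 'E_P[W t n]%E|).
  by apply: measurableT_comp => //; exact: measurable_funB.
have mE2 : measurable E2.
  have -> : E2 = (fun w => `|W t n w - fine 'E_P[W t n]%E|) @^-1`
      `[L * expR (b n), +oo[%classic.
    by apply/seteqP; split => w /=; rewrite in_itv/= andbT.
  by rewrite -[X in measurable X]setTI; exact: mW.
have PE1 : (P E1 <= (eps / 2)%:E)%E.
  apply: (le_trans (Boole_inequality P (fun i _ => mgt i))).
  have m1 : measurable_fun [set: R] (\1_(`]t, +oo[%classic) : R -> R).
    exact: measurable_indic.
  have Pi i : P [set w | t < S i n w] =
      (\int[Q n]_x (\1_(`]t, +oo[%classic) x)%:E)%E.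
    rewrite -(integral_row_sum i)//.
    transitivity (\int[P]_w (\1_[set w | t < S i n w] w)%:E)%E.
      by rewrite integral_indic// setIT.
    apply: eq_integral => w _; rewrite !indicE; congr (_ %:R)%:E.
    by congr (nat_of_bool _); apply/idP/idP; rewrite !inE /= in_itv/= andbT.
  apply: (@le_trans _ _
      (\sum_(i < N n) \int[Q n]_x (\1_(`]t, +oo[%classic) x)%:E)%E).
    by apply: lee_sum => i _; rewrite -(Pi i).
  rewrite sum_const; last by apply: integral_ge0 => x _; rewrite lee_fin.
  (* With [kappa = alpha] and [q = - (alpha * t)] the exponent vanishes for [x > t], so it dominates
     the indicator. *)
  apply: le_trans (HC1 n t (- (alpha * t)) _ m1 _) _.
    move=> x; rewrite indicE; case: (boolP (x \in _)) => /= [|_].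
      rewrite inE/= in_itv/= andbT => tx.
      rewrite ler01/= ger0_norm ?subr_ge0 ?(ltW tx)//.
      by rewrite -[leLHS]expR0 ler_expR; lra.
    by rewrite lexx expR_ge0.
  rewrite lee_fin /t; apply: le_trans es.
  by rewrite ler_pM2l// ler_expR; lra.
have PE2 : (P E2 <= (eps / 2)%:E)%E.
  have Lb : 0 < L * expR (b n) by rewrite mulr_gt0// expR_gt0.
  apply: (le_trans (chebyshev (W t n) Lb)).
  apply: (@le_trans _ _ ((L * expR (b n)) ^- 2 *
      (C2 * expR ((2 - alpha) * t + alpha * b n)))%:E).
    rewrite EFinM lee_wpmul2l ?lee_fin ?invr_ge0 ?exprn_ge0 ?(ltW Lb)//.
    apply: (le_trans (variance_W t n)).
    (* With [kappa = 2 - alpha] and [q = (2 - alpha) * t] the exponent is [2 * x] for [x <= t]. *)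
    apply: (HC2 n t ((2 - alpha) * t) _ (mY2 t)) => x; rewrite sqr_ge0/= truncated_expE.
    case: ifPn => [xt|_]; last by rewrite expr0n/= expR_ge0.
    rewrite -expRM_natr ler_expR distrC ger0_norm ?subr_ge0//.
    by rewrite [leRHS](_ : _ = x * 2%:R)//; ring.
  rewrite lee_fin; apply: le_trans LV; rewrite /V /t.
  have -> : expR ((2 - alpha) * (b n + s) + alpha * b n) =
     expR ((2 - alpha) * s) * expR (b n) ^+ 2.
    by rewrite -expRM_natr -expRD; congr expR; ring.
  rewrite le_eqVlt; apply/orP; left; apply/eqP.
  by field; rewrite !gt_eqF// expR_gt0.
apply: (@le_trans _ _ (P (E1 `|` E2))); last first.
  rewrite (splitr eps) EFinD; apply: le_trans (measureU2 P mE1 mE2) _.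
  exact: leeD.
apply: le_measure; rewrite ?inE; [|exact: measurableU|].
  have mZ : measurable_fun [set: T]
      (fun w => `|(sumexp Xs N n w - A n) / expR (b n)|).
    apply: measurableT_comp => //; apply: measurable_funM => //.
    apply: measurable_funB => //; apply: measurable_sum => i.
    by apply: measurable_prod => j _; exact: measurableT_comp.
  have -> : [set w | K + L < `|(sumexp Xs N n w - A n) / expR (b n)|] =
      (fun w => `|(sumexp Xs N n w - A n) / expR (b n)|) @^-1` `]K + L, +oo[%classic.
    by apply/seteqP; split => w /=; rewrite in_itv/= andbT.
  by rewrite -[X in measurable X]setTI; exact: mZ.
move=> w /= Hw; have [|nE1] := pselect (E1 w); [by left|right].
have Sle i : (i < N n)%N -> S i n w <= t.
  move=> iN; rewrite leNgt; apply/negP => tS; apply: nE1.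
  by rewrite /E1 -(bigcup_mkord _ (fun j => [set w | t < S j n w])); exists i.
have ZW : sumexp Xs N n w = W t n w.
  rewrite WE /sumexp; apply: eq_bigr => i _.
  by rewrite YE truncated_expE Sle// row_sumE expR_sum.
rewrite /E2 /= expectation_W/= -/tau leNgt; apply/negP => W_lt.
move: Hw; rewrite ltNge => /negP; apply.
rewrite normrM normfV (ger0_norm (expR_ge0 _)) ler_pdivrMr ?expR_gt0// ZW mulrDl.
have -> : W t n w - A n = (tau - A n) + (W t n w - tau) by ring.
by rewrite (le_trans (ler_normD _ _))// lerD ?HK// ltW.
Qed.

End tightness.

(** * Expectations occurring in the centering *)

Section expectations.
Context {R : realType} {d0 d : measure_display}
  {T0 : measurableType d0} {T : measurableType d}.
Variables (P0 : probability T0 R) (X : {RV P0 >-> R}).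
Variables (P : probability T R) (Xs : nat -> nat -> {RV P >-> R}).
Hypothesis Xs_indep : mutually_independent P (fun k : nat * nat => Xs k.1 k.2).
Hypothesis Xs_copies : forall i j, is_copy P P0 (Xs i j) X.

Lemma expectation_sumexp (N : nat -> nat) n :
  (forall t : R, 0 <= t -> log_mgfe P0 X t \is a fin_num) ->
  'E_P[sumexp Xs N n]%E = ((N n)%:R * expR (log_mgf P0 X 1 * n%:R))%:E.
Proof.
move=> fin_mgf; rewrite unlock.
have Z w : (sumexp Xs N n w)%:E = (\sum_(i < N n) (expR (row_sum P Xs i n w))%:E)%E.
  by rewrite sumEFin /sumexp; congr EFin; apply: eq_bigr => i _; rewrite row_sumE expR_sum.
under eq_integral do rewrite Z.
have mexp : measurable_fun [set: R] (fun x : R => (expR x)%:E).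
  exact/measurable_EFinP.
rewrite ge0_integral_sum//; last first.
  by move=> i; exact: (measurableT_comp mexp).
have e i : (\int[P]_w (expR (row_sum P Xs i n w))%:E = (expR (log_mgf P0 X 1 * n%:R))%:E)%E.
  rewrite (@ge0_integral_row_sum _ _ _ _ _ P0 X P Xs _ _ i n (fun x => (expR x)%:E))//.
  rewrite -(row_sum_mgf P0 X fin_mgf P Xs Xs_indep Xs_copies 1 n ler01).
  by apply: eq_integral => x _; rewrite mul1r.
under eq_bigr do rewrite e.
by rewrite sumEFin sumr_const card_ord mulr_natl.
Qed.

Lemma expectation_truncated_rowsum n (t : R) :
  fine 'E_P[fun w => expR (rowsum Xs n w) * \1_[set v | rowsum Xs n v <= t] w] =
  fine (\int[row_sum_law P Xs n]_x (truncated_exp t x)%:E)%E.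
Proof.
congr fine; rewrite unlock.
rewrite -(@ge0_integral_row_sum _ _ _ _ _ P0 X P Xs _ _ 0 n (fun x => (truncated_exp t x)%:E))//;
  last 2 first.
- by apply/measurable_EFinP; exact: measurable_truncated_exp.
- by move=> x; rewrite lee_fin truncated_exp_ge0.
apply: eq_integral => w _; rewrite truncated_expE row_sumE -/(rowsum Xs n w) indicE.
case: ifPn => [le|nle]; first by rewrite mem_set// mulr1.
by rewrite memNset ?mulr0//=; exact/negP.
Qed.

End expectations.

(** * Scaled concentration bound and error of the centering *)

Section scaling.
Context {R : realType} {d0 d : measure_display}
  {T0 : measurableType d0} {T : measurableType d}.
Variables (P0 : probability T0 R) (X : {RV P0 >-> R}).
Hypothesis fin_mgf : forall t : R, 0 <= t -> log_mgfe P0 X t \is a fin_num.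
Hypothesis X_nondegenerate : nondegenerate_RV P0 X.
Variable h : R.
Hypotheses (h_gt0 : 0 < h) (X_lattice : on_lattice P0 X h).
Variables (P : probability T R) (Xs : nat -> nat -> {RV P >-> R}).
Hypothesis Xs_indep : mutually_independent P (fun k : nat * nat => Xs k.1 k.2).
Hypothesis Xs_copies : forall i j, is_copy P P0 (Xs i j) X.

Let phi := log_mgf P0 X.
Let Q := row_sum_law P Xs.

Variables (N : nat -> nat) (c alpha : R).
Hypothesis N_cvg : expR (- c * n%:R) * (N n)%:R @[n --> \oo] --> (1 : R).
Hypotheses (alpha_gt0 : 0 < alpha)
  (c_alpha : c = alpha * phi^`()%classic alpha - phi alpha).

Let b := log_scaling phi alpha h.

(** [N n] is at most a constant times [expR (c * n)]. By [c_alpha], multiplying by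
    [expR (phi alpha * n)] gives [expR (alpha * phi' alpha * n)], and [log_scaling_lower] absorbs
    the factor [1 / sqrt (n + 1)]. *)
Lemma scaled_row_sum_le (kappa : R) : 0 < kappa ->
  exists2 C, 0 < C & forall n t q (u : R -> R), measurable_fun [set: R] u ->
    (forall x, 0 <= u x <= expR (q + alpha * x - kappa * `|x - t|)) ->
    ((N n)%:R%:E * \int[Q n]_x (u x)%:E <= (C * expR (q + alpha * b n))%:E)%E.
Proof.
move=> k0.
have [C1 C10 HC1] := @tilted_row_sum_le _ _ _ _ _ P0 X fin_mgf P Xs Xs_indep Xs_copies
  h X_nondegenerate X_lattice alpha alpha_gt0 kappa k0.
have [C2 C20 HC2] := @log_scaling_lower R phi alpha h alpha_gt0 h_gt0.
have [C3 C30 HC3] : exists2 C, 0 < C & forall n, (N n)%:R <= C * expR (c * n%:R).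
  have /cvg_seq_bounded [M [Mr HM]] := cvgP _ N_cvg.
  have M1 : M < `|M| + 1 by rewrite (le_lt_trans (ler_norm M))// ltrDl.
  exists (`|M| + 1) => [|n]; first by rewrite ltr_wpDl.
  have := HM _ M1 n I; rewrite /= ger0_norm ?mulr_ge0 ?expR_ge0// => le1.
  by rewrite -ler_pdivrMr ?expR_gt0// -expRN -mulNr mulrC.
exists (C3 * C1 * C2) => [|n t q u mu u_le]; first by rewrite !mulr_gt0.
have u0 x : 0 <= u x by have /andP[] := u_le x.
have mg : measurable_fun [set: R] (fun x => expR (alpha * x - kappa * `|x - t|)).
  apply: measurableT_comp => //; apply: measurable_funB => //.
  apply: measurable_funM => //; apply: measurableT_comp => //.
  exact: measurable_funB.
have mg' : measurable_fun [set: R]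
    (fun x => (expR (alpha * x - kappa * `|x - t|))%:E) by exact/measurable_EFinP.
have int_u : (\int[Q n]_x (u x)%:E <=
    (expR q * (C1 * (expR (phi alpha * n%:R) / Num.sqrt n.+1%:R)))%:E)%E.
  rewrite EFinM.
  apply: (@le_trans _ _ ((expR q)%:E *
      \int[Q n]_x (expR (alpha * x - kappa * `|x - t|))%:E)%E); last first.
    by rewrite lee_wpmul2l ?lee_fin ?expR_ge0// HC1.
  rewrite -ge0_integralZl//.
  apply: ge0_le_integral => //.
  - by move=> x _; rewrite lee_fin.
  - exact/measurable_EFinP.
  - by apply: emeasurable_funM.
  - by move=> x _; rewrite -EFinM -expRD addrA lee_fin; have /andP[] := u_le x.
apply: (@le_trans _ _ ((N n)%:R%:E *
    (expR q * (C1 * (expR (phi alpha * n%:R) / Num.sqrt n.+1%:R)))%:E)%E).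
  by rewrite lee_wpmul2l ?lee_fin.
rewrite -EFinM lee_fin.
apply: (@le_trans _ _ (C3 * expR (c * n%:R) *
    (expR q * (C1 * (expR (phi alpha * n%:R) / Num.sqrt n.+1%:R))))).
  by rewrite ler_wpM2r// mulr_ge0 ?expR_ge0// mulr_ge0 ?(ltW C10)// divr_ge0 ?expR_ge0.
have -> : C3 * expR (c * n%:R) *
    (expR q * (C1 * (expR (phi alpha * n%:R) / Num.sqrt n.+1%:R))) =
    C3 * C1 * expR q *
    (expR (alpha * phi^`()%classic alpha * n%:R) / Num.sqrt n.+1%:R).
  have -> : expR (alpha * phi^`()%classic alpha * n%:R) =
      expR (c * n%:R) * expR (phi alpha * n%:R).
    by rewrite -expRD c_alpha; congr expR; ring.
  by ring.
have -> : C3 * C1 * C2 * expR (q + alpha * b n) =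
    C3 * C1 * expR q * (C2 * expR (alpha * b n)) by rewrite expRD; ring.
by rewrite ler_wpM2l ?HC2// !mulr_ge0 ?expR_ge0 ?(ltW C30) ?(ltW C10).
Qed.

Let trunc_ge0 (t x : R) : (0 <= (truncated_exp t x)%:E)%E.
Proof. by rewrite lee_fin truncated_exp_ge0. Qed.

Let mtrunc (t : R) : measurable_fun [set: R] (fun x => (truncated_exp t x)%:E).
Proof. by apply/measurable_EFinP; exact: measurable_truncated_exp. Qed.

Let int_trunc_fin t n : (\int[Q n]_x (truncated_exp t x)%:E)%E \is a fin_num.
Proof.
rewrite ge0_fin_numE; last exact: integral_ge0.
apply: (@le_lt_trans _ _ (\int[Q n]_x cst (expR t)%:E x)%E); last first.
  by apply/integrable_lty => //; exact: finite_measure_integrable_cst.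
apply: ge0_le_integral => //.
by move=> x _; rewrite lee_fin truncated_exp_le.
Qed.

Let exp_gt (t x : R) : R := expR x * \1_(`]t, +oo[%classic) x.

Let exp_gtE t x : exp_gt t x = if t < x then expR x else 0.
Proof.
rewrite /exp_gt indicE; have [tx|tx] := ltP t x.
  by rewrite mem_set ?mulr1//= in_itv/= tx.
by rewrite memNset ?mulr0//= in_itv/= andbT; apply/negP; rewrite -leNgt.
Qed.

Let exp_gt_ge0 t x : 0 <= exp_gt t x.
Proof. by rewrite exp_gtE; case: ifP => // _; exact: expR_ge0. Qed.

Let mexp_gt t : measurable_fun [set: R] (exp_gt t).
Proof. by apply: measurable_funM => //; exact: measurable_indic. Qed.

Let exp_split t n : (\int[Q n]_x (expR x)%:E =
  \int[Q n]_x (truncated_exp t x)%:E + \int[Q n]_x (exp_gt t x)%:E)%E.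
Proof.
rewrite -ge0_integralD//; last 2 first.
- by move=> x _; rewrite lee_fin exp_gt_ge0.
- by apply/measurable_EFinP; exact: mexp_gt.
apply: eq_integral => x _; rewrite -EFinD truncated_expE exp_gtE.
by case: leP => _; rewrite ?addr0 ?add0r.
Qed.

(** The error is the mean lost above [t]. For [x > t], [q = (1 - alpha) * t] and [kappa = alpha - 1]
    make the exponent equal to [x]. *)
Lemma centering_gt1_le (s : R) : 1 < alpha -> exists K, forall n,
  `|(N n)%:R * fine (\int[Q n]_x (truncated_exp (b n + s) x)%:E)%E -
    (N n)%:R * expR (phi 1 * n%:R)| <= K * expR (b n).
Proof.
move=> a1; have k0 : 0 < alpha - 1 by rewrite subr_gt0.
have [C C0 HC] := scaled_row_sum_le _ k0.
exists (C * expR ((1 - alpha) * s)) => n; set t := b n + s.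
have := row_sum_mgf P0 X fin_mgf P Xs Xs_indep Xs_copies 1 n ler01.
under eq_integral do rewrite mul1r.
rewrite (exp_split t) => E.
have I0 : (0 <= \int[Q n]_x (exp_gt t x)%:E)%E.
  by apply: integral_ge0 => x _; rewrite lee_fin exp_gt_ge0.
have If : (\int[Q n]_x (exp_gt t x)%:E)%E \is a fin_num.
  move: E; rewrite -(fineK (int_trunc_fin t n)).
  by case: (\int[Q n]_x (exp_gt t x)%:E)%E I0.
have := HC n t ((1 - alpha) * t) (exp_gt t) (mexp_gt t).
rewrite -(fineK If) -EFinM lee_fin => H.
move: E; rewrite -(fineK If) -(fineK (int_trunc_fin t n)) -EFinD => -[<-].
rewrite -mulrBr opprD addNKr mulrN normrN ger0_norm ?mulr_ge0 ?fine_ge0//.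
apply: (le_trans (H _)) => [x|].
  rewrite exp_gt_ge0/= exp_gtE; case: ifP => [tx|_]; last exact: expR_ge0.
  rewrite ler_expR ger0_norm ?subr_ge0 ?(ltW tx)//.
  by rewrite [leRHS](_ : _ = x)//; ring.
rewrite -mulrA -expRD ler_pM2l// ler_expR /t.
by rewrite [leRHS](_ : _ = (1 - alpha) * (b n + s) + alpha * b n)//; ring.
Qed.

(** The truncated mean is itself of order [expR (b n)]: for [x <= t], [q = (1 - alpha) * t] and
    [kappa = 1 - alpha] make the exponent equal to [x]. *)
Lemma centering_lt1_le (s : R) : alpha < 1 -> exists K, forall n,
  `|(N n)%:R * fine (\int[Q n]_x (truncated_exp (b n + s) x)%:E)%E - 0|
    <= K * expR (b n).
Proof.
move=> a1; have k0 : 0 < 1 - alpha by rewrite subr_gt0.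
have [C C0 HC] := scaled_row_sum_le _ k0.
exists (C * expR ((1 - alpha) * s)) => n; set t := b n + s.
have I0 : 0 <= fine (\int[Q n]_x (truncated_exp t x)%:E)%E.
  by rewrite fine_ge0// integral_ge0.
have := HC n t ((1 - alpha) * t) _ (measurable_truncated_exp R t).
rewrite -(fineK (int_trunc_fin t n)) -EFinM lee_fin => H.
rewrite subr0 ger0_norm ?mulr_ge0//.
apply: (le_trans (H _)) => [x|].
  rewrite truncated_exp_ge0/= truncated_expE; case: ifP => [xt|_]; last exact: expR_ge0.
  rewrite ler_expR distrC ger0_norm ?subr_ge0//.
  by rewrite [leRHS](_ : _ = x)//; ring.
rewrite -mulrA -expRD ler_pM2l// ler_expR /t.
by rewrite [leRHS](_ : _ = (1 - alpha) * (b n + s) + alpha * b n)//; ring.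
Qed.

(** The error is the mean carried by the window from [b n] to [b n + s]. There [kappa = 1] and
    [q = s] make the exponent [x + (x - b n)], at least [x]. *)
Lemma centering_eq1_le (s : R) : 0 <= s -> alpha = 1 -> exists K, forall n,
  `|(N n)%:R * fine (\int[Q n]_x (truncated_exp (b n + s) x)%:E)%E -
    (N n)%:R * fine (\int[Q n]_x (truncated_exp (b n) x)%:E)%E| <= K * expR (b n).
Proof.
move=> s0 a1; have [C C0 HC] := scaled_row_sum_le _ (@ltr01 R).
exists (C * expR s) => n; set t := b n + s.
pose u x := truncated_exp t x - truncated_exp (b n) x.
have mu : measurable_fun [set: R] u.
  by apply: measurable_funB; exact: measurable_truncated_exp.
have uE x : u x = if b n < x <= t then expR x else 0.
  rewrite /u !truncated_expE; have [xb|bx] := leP x (b n) => /=; last by rewrite subr0.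
  by rewrite (le_trans xb) ?subrr// lerDl.
have u0 x : 0 <= u x by rewrite uE; case: ifP => // _; exact: expR_ge0.
have E : (\int[Q n]_x (truncated_exp t x)%:E =
    \int[Q n]_x (truncated_exp (b n) x)%:E + \int[Q n]_x (u x)%:E)%E.
  rewrite -ge0_integralD//.
  - by apply: eq_integral => x _; rewrite -EFinD /u subrKC.
  - by move=> x _; rewrite lee_fin.
  - exact/measurable_EFinP.
have I0 : (0 <= \int[Q n]_x (u x)%:E)%E.
  by apply: integral_ge0 => x _; rewrite lee_fin.
have If : (\int[Q n]_x (u x)%:E)%E \is a fin_num.
  move: E; rewrite -(fineK (int_trunc_fin t n)) -(fineK (int_trunc_fin (b n) n)).
  by case: (\int[Q n]_x (u x)%:E)%E I0.
have := HC n t s u mu.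
rewrite -(fineK If) -EFinM lee_fin => H.
rewrite E fineD// mulrDr addrAC subrr add0r ger0_norm ?mulr_ge0 ?fine_ge0//.
apply: (le_trans (H _)) => [x|].
  rewrite u0/= uE; case: ifP => [/andP[bx xt]|_]; last exact: expR_ge0.
  rewrite ler_expR distrC ger0_norm ?subr_ge0// a1 !mul1r.
  have -> : s + x - (t - x) = x + (x - b n) by rewrite /t; ring.
  by rewrite lerDl subr_ge0 ltW.
by rewrite -mulrA -expRD a1 mul1r.
Qed.

End scaling.

(** Row lengths start at 1, hence [n.+1]. The first conjunct certifies that, for [c1 < c], the
    [fine] in [centering] hides no infinite expectation and that the centering has its closed
    form. *)
Theorem corollary1 (R : realType)
  (d0 : measure_display) (T0 : measurableType d0) (P0 : probability T0 R)
  (X : {RV P0 >-> R})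
  (hX : nondegenerate_RV P0 X)
  (hphi : forall t : R, 0 <= t -> log_mgfe P0 X t \is a fin_num)
  (h : R) (h_gt0 : 0 < h)
  (h_lattice : on_lattice P0 X h)
  (h_max : forall h' : R, 0 < h' -> on_lattice P0 X h' -> h' <= h)
  (d : measure_display) (T : measurableType d) (P : probability T R)
  (Xs : nat -> nat -> {RV P >-> R})
  (Xs_indep : mutually_independent P (fun k : nat * nat => Xs k.1 k.2))
  (Xs_copies : forall i j, is_copy P P0 (Xs i j) X) :
  let phi := log_mgf P0 X in
  let c1 := phi^`()%classic 1 - phi 1 in
  let c2 := 2 * phi^`()%classic 2 - phi 2 in
  forall (c : R) (c_gt0 : 0 < c) (c_lt2 : c < c2)
    (N : nat -> nat)
    (hN : expR (- c * n%:R) * (N n)%:R @[n --> \oo] --> (1 : R))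
    (alpha : R) (alpha_gt0 : 0 < alpha) (alpha_lt2 : alpha < 2)
    (halpha : rate phi (phi^`()%classic alpha) = c%:E),
  let b := log_scaling phi alpha h in
  let B := fun n => expR (b n) in
  let Z := sumexp Xs N in
  let A := centering P Xs N c1 c b in
  (c1 < c -> forall n, ('E_P[Z n.+1])%E = ((N n.+1)%:R * expR (phi 1 * n.+1%:R))%:E)
  /\ tight P (fun n w => (Z n.+1 w - A n.+1) / B n.+1).
Proof.
move=> phi c1 c2 c c_gt0 c_lt2 N hN alpha alpha_gt0 alpha_lt2 halpha b B Z A.
have tangent := @log_mgf_gt_tangent _ _ _ P0 X hphi hX.
have c_alpha : c = alpha * phi^`()%classic alpha - phi alpha.
  by apply: EFin_inj; rewrite -halpha (@rate_derive1 _ _ tangent).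
have c1E : c1 = 1 * phi^`()%classic 1 - phi 1 by rewrite mul1r.
have expZ n := @expectation_sumexp _ _ _ _ _ P0 X P Xs Xs_indep Xs_copies N n hphi.
split=> [_ n|]; first exact: expZ.
have tightZ : tight P (fun n w => (Z n w - A n) / B n).
  apply: (@tight_normalized_sumexp _ _ _ _ _ P0 X P Xs Xs_indep Xs_copies N alpha b A) => //.
    exact: (@scaled_row_sum_le _ _ _ _ _ P0 X hphi hX h h_gt0 h_lattice P Xs
      Xs_indep Xs_copies N c alpha hN alpha_gt0 c_alpha).
  move=> s s0.
  (* Since [c] and [c1] are the values of the strictly increasing [a * phi' a - phi a] at [alpha]
     and 1, they compare as [alpha] and 1 do. *)
  have A_gt : 1 < alpha -> forall n, A n = (N n)%:R * expR (phi 1 * n%:R).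
    move=> a1 n; have c1c : c1 < c.
      by rewrite c1E c_alpha; exact: (@rate_derive1_lt _ _ tangent).
    by rewrite /A /centering c1c expZ.
  have A_lt : alpha < 1 -> forall n, A n = 0.
    move=> a1 n; have cc1 : c < c1.
      by rewrite c1E c_alpha; exact: (@rate_derive1_lt _ _ tangent).
    by rewrite /A /centering ltNge (ltW cc1)/= lt_eqF.
  have A_eq : alpha = 1 -> forall n, A n =
      (N n)%:R * fine (\int[row_sum_law P Xs n]_x (truncated_exp (b n) x)%:E)%E.
    move=> a1 n; have cc1 : c = c1 by rewrite c1E c_alpha a1.
    rewrite /A /centering cc1 ltxx eqxx.
    by rewrite (@expectation_truncated_rowsum _ _ _ _ _ P0 X P Xs).
  have [a1|a1|a1] := ltgtP alpha 1.
  - have [K HK] := @centering_lt1_le _ _ _ _ _ P0 X hphi hX h h_gt0 h_lattice P Xs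
      Xs_indep Xs_copies N c alpha hN alpha_gt0 c_alpha s a1.
    by exists K => n; rewrite A_lt.
  - have [K HK] := @centering_gt1_le _ _ _ _ _ P0 X hphi hX h h_gt0 h_lattice P Xs
      Xs_indep Xs_copies N c alpha hN alpha_gt0 c_alpha s a1.
    by exists K => n; rewrite A_gt.
  - have [K HK] := @centering_eq1_le _ _ _ _ _ P0 X hphi hX h h_gt0 h_lattice P Xs
      Xs_indep Xs_copies N c alpha hN alpha_gt0 c_alpha s s0 a1.
    by exists K => n; rewrite A_eq.
move=> eps eps0; have [M HM] := tightZ eps eps0.
by exists M => n; exact: HM.
Qed.
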